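(* Let $\mathfrak{g}=\mathfrak{g}(A)$ be any Borcherds--Kac--Moody (BKM) Lie algebra, let $\lambda\in\mathfrak{h}^*$, and let $V\neq 0$ be a highest weight $\mathfrak{g}$-module with highest weight $\lambda$ whose hole-set $\mathcal{H}_V$ is nice (this includes the simple module $V=L(\lambda)$ for every $\lambda\in\mathfrak{h}^*$). Then $$\mathrm{wt}\,V \;=\; W_{I_V}\big\{\mu\preceq\lambda \;\big|\; \mu \text{ satisfies conditions (C1) and (C2)}\big\},$$ where: (C1) $\mu(\alpha_i^\vee)\in\mathbb{Z}_{\geq 0}$ for all $i\in I_V$. (C2) If $\mu\neq\lambda$, write $\mu=\lambda-\sum_{j\in J}c_j\alpha_j$ with $J=\mathrm{supp}(\lambda-\mu)\neq\emptyset$ and $c_j\in\mathbb{Z}_{>0}$ for all $j\in J$, and let $J=J_1\sqcup\cdots\sqcup J_n$ be the decomposition of $J$ into connected components of the Dynkin subgraph induced on $J$. Then there exist nodes $j_k\in J_k$ for $1\le k\le n$ such that $$\mu' := \lambda-\sum_{k:\,|J_k|=1}c_{j_k}\alpha_{j_k}-\sum_{k:\,|J_k|>1}\alpha_{j_k}\ \in\ \mathrm{wt}\,V .$$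
   Context: BKM-Cartan matrix: a real matrix $A=(A_{ij})_{i,j\in\mathcal{I}}$, $\mathcal{I}$ finite, with $A_{ii}\in\{2\}\sqcup\mathbb{R}_{\le0}$; $A_{ij}=0\iff A_{ji}=0$; $A_{ij}\in\mathbb{R}_{\le 0}$ for $i\ne j$; and $A_{ij}\in\mathbb{Z}_{\le0}$ whenever $A_{ii}=2$, $j\neq i$. Put $\mathcal{I}^+=\{i: A_{ii}=2\}$, $\mathcal{I}^0=\{i:A_{ii}=0\}$, $\mathcal{I}^-=\{i:A_{ii}<0\}$. The BKM Lie algebra $\mathfrak{g}=\mathfrak{g}(A)$ over $\mathbb{C}$ has Cartan subalgebra $\mathfrak{h}$ ($\dim\mathfrak{h}=|\mathcal{I}|+\text{nullity}(A)$), linearly independent simple roots $\Pi=\{\alpha_i\}\subset\mathfrak{h}^*$ and simple co-roots $\{\alpha_i^\vee\}\subset\mathfrak{h}$ with $\alpha_j(\alpha_i^\vee)=A_{ij}$, and Chevalley generators $e_i,f_i$ ($i\in\mathcal I$), with the usual relations ($[h,e_i]=\alpha_i(h)e_i$, $[h,f_i]=-\alpha_i(h)f_i$, $[e_i,f_j]=\delta_{ij}\alpha_i^\vee$), the Serre relations $\mathrm{ad}_{e_i}^{1-A_{ij}}(e_j)=0=\mathrm{ad}_{f_i}^{1-A_{ij}}(f_j)$ for $i\in\mathcal{I}^+$, $j\ne i$, and $[e_i,e_j]=[f_i,f_j]=0$ when $A_{ij}=0$. The Weyl group $W$ is generated by the reflections $s_i$, $i\in\mathcal{I}^+$; for $K\subseteq\mathcal{I}^+$,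 $W_K=\langle s_i: i\in K\rangle$. The Dynkin graph has vertex set $\mathcal{I}$ with an edge between $i\ne j$ iff $A_{ij}\neq0$. A subset $H\subseteq\mathcal{I}$ is independent if it has no edges between its nodes. For $x=\sum_i c_i\alpha_i$, $\mathrm{supp}(x)=\{i: c_i\ne0\}$. $\mu\preceq\lambda$ means $\lambda-\mu\in\mathbb{Z}_{\ge0}\Pi$. $M(\lambda)$ is the Verma module, $L(\lambda)$ its simple quotient, a highest weight module of highest weight $\lambda$ is a nonzero quotient $V$ of $M(\lambda)$, $V_\mu$ is its $\mu$-weight space, and $\mathrm{wt}\,V=\{\mu: V_\mu\neq0\}$. $J_\lambda:=\{i\in\mathcal{I}: \lambda(\alpha_i^\vee)\in\frac{A_{ii}}{2}\mathbb{Z}_{\ge0}\}$ (so $\lambda(\alpha_i^\vee)=0$ for $i\in J_\lambda\cap\mathcal{I}^0$). $I_V:=\{i\in\mathcal{I}^+:\lambda(\alpha_i^\vee)\in\mathbb{Z}_{\ge0},\ f_i^{\lambda(\alpha_i^\vee)+1}V_\lambda=0\}$. Hole-set $\mathcal{H}_V$: the set of all pairs $(H,m_H)$ such that (H1) $\emptyset\neq H\subseteq J_\lambda$ is independent; (H2) $m_H:H\to\mathbb{Z}_{\ge0}$ satisfies $m_H(h)=\frac{2}{A_{hh}}\lambda(\alpha_h^\vee)+1$ for $h\in H\cap(\mathcal{I}^+\sqcup\mathcal{I}^-)$, while $m_H(h)\ge1$ is arbitrary for $h\in H\cap\mathcal{I}^0$; (H3) $\big(\prod_{h\in H}f_h^{m_H(h)}\big)V_\lambda=0$.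 A hole $(H,m_H)\in\mathcal{H}_V$ is minimal if there is no $(J,m_J)\in\mathcal{H}_V$ different from $(H,m_H)$ with $J\subseteq H$ and $m_J(j)\le m_H(j)$ for all $j\in J$; $\mathcal{H}_V^{\min}$ is the set of minimal holes. $\mathcal{H}_V$ is nice if for every $(H,m_H)\in\mathcal{H}_V^{\min}$, either $H\subseteq\mathcal{I}^-\sqcup\mathcal{I}^0$, or $H\subseteq\mathcal{I}^+$ and $|H|=1$. *)

(* Defs.v *)
From HB Require Import structures.
From mathcomp Require Import all_boot all_order all_algebra.
From mathcomp Require Import generic_quotient.
From mathcomp Require Import boolp classical_sets reals.
From mathcomp Require Import complex.

Set Implicit Arguments.
Unset Strict Implicit.
Unset Printing Implicit Defensive.

Import Order.TTheory GRing.Theory Num.Theory.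
Local Open Scope quotient_scope.
Local Open Scope complex_scope.
Local Open Scope ring_scope.

HB.mixin Record Lmodule_isLie (K : fieldType) (G : Type) of GRing.Lmodule K G := {
  lie : G -> G -> G;
  lie_linl : forall y, linear (lie^~ y);
  lie_linr : forall x, linear (lie x);
  liexx : forall x, lie x x = 0;
  lie_jacobi : forall x y z,
    lie x (lie y z) + lie y (lie z x) + lie z (lie x y) = 0
}.

#[short(type="lieAlgType")]
HB.structure Definition LieAlgebra (K : fieldType) :=
  {G of GRing.Lmodule K G & Lmodule_isLie K G}.

HB.mixin Record Lmodule_isLieModule (K : fieldType) (G : lieAlgType K) (V : Type)
    of GRing.Lmodule K V := {
  act : G -> V -> V;
  act_linl : forall v, linear (act^~ v);
  act_linr : forall x, linear (act x);
  act_lie : forall x y v, act (lie x y) v = act x (act y v) - act y (act x v)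
}.

#[short(type="lieModType")]
HB.structure Definition LieModule (K : fieldType) (G : lieAlgType K) :=
  {V of GRing.Lmodule K V & Lmodule_isLieModule K G V}.

(* The Lie algebra presented by generators X and relations rel: formal Lie
   expressions in X, modulo the least congruence that contains rel and the
   axioms of a Lie algebra over K. *)

Inductive lterm (K X : Type) : Type :=
| LGen of X
| LZero
| LAdd of lterm K X & lterm K X
| LOpp of lterm K X
| LScale of K & lterm K X
| LBr of lterm K X & lterm K X.

Arguments LGen {K X} _.
Arguments LZero {K X}.

HB.instance Definition _ (K X : Type) := gen_eqMixin (lterm K X).
HB.instance Definition _ (K X : Type) := gen_choiceMixin (lterm K X).

Inductive lcongr (K : fieldType) (X : Type)
    (rel : lterm K X -> lterm K X -> Prop) : lterm K X -> lterm K X -> Prop :=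
| lcongr_rel s t : rel s t -> lcongr rel s t
| lcongr_refl s : lcongr rel s s
| lcongr_sym s t : lcongr rel s t -> lcongr rel t s
| lcongr_trans s t u : lcongr rel s t -> lcongr rel t u -> lcongr rel s u
| lcongr_add s s' t t' :
    lcongr rel s s' -> lcongr rel t t' -> lcongr rel (LAdd s t) (LAdd s' t')
| lcongr_opp s s' : lcongr rel s s' -> lcongr rel (LOpp s) (LOpp s')
| lcongr_scale a s s' :
    lcongr rel s s' -> lcongr rel (LScale a s) (LScale a s')
| lcongr_br s s' t t' :
    lcongr rel s s' -> lcongr rel t t' -> lcongr rel (LBr s t) (LBr s' t')
| lcongr_addA s t u :
    lcongr rel (LAdd s (LAdd t u)) (LAdd (LAdd s t) u)
| lcongr_addC s t : lcongr rel (LAdd s t) (LAdd t s)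
| lcongr_add0 s : lcongr rel (LAdd LZero s) s
| lcongr_addN s : lcongr rel (LAdd (LOpp s) s) LZero
| lcongr_scaleA a b s :
    lcongr rel (LScale a (LScale b s)) (LScale (a * b) s)
| lcongr_scale1 s : lcongr rel (LScale 1 s) s
| lcongr_scaleDr a s t :
    lcongr rel (LScale a (LAdd s t)) (LAdd (LScale a s) (LScale a t))
| lcongr_scaleDl s a b :
    lcongr rel (LScale (a + b) s) (LAdd (LScale a s) (LScale b s))
| lcongr_br_linl a s t u :
    lcongr rel (LBr (LAdd (LScale a s) t) u)
               (LAdd (LScale a (LBr s u)) (LBr t u))
| lcongr_br_linr u a s t :
    lcongr rel (LBr u (LAdd (LScale a s) t))
               (LAdd (LScale a (LBr u s)) (LBr u t))
| lcongr_brxx s : lcongr rel (LBr s s) LZero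
| lcongr_jacobi s t u :
    lcongr rel
      (LAdd (LAdd (LBr s (LBr t u)) (LBr t (LBr u s))) (LBr u (LBr s t))) LZero.

Section PresentedLieAlgebra.
Variables (K : fieldType) (X : Type) (rel : lterm K X -> lterm K X -> Prop).

Definition lcongrb : lterm K X -> lterm K X -> bool := fun s t => `[< lcongr rel s t >].

Lemma lcongrb_refl : reflexive lcongrb.
Proof. by move=> s; apply/asboolP/lcongr_refl. Qed.

Lemma lcongrb_sym : symmetric lcongrb.
Proof. by move=> s t; apply/asboolP/asboolP => /lcongr_sym. Qed.

Lemma lcongrb_trans : transitive lcongrb.
Proof.
by move=> t s u /asboolP st /asboolP tu; apply/asboolP/(lcongr_trans st tu).
Qed.

Canonical lcongrb_equiv :=
  EquivRel lcongrb lcongrb_refl lcongrb_sym lcongrb_trans.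

Definition liepres : Type := {eq_quot lcongrb}.

HB.instance Definition _ := EqQuotient.on liepres.
HB.instance Definition _ := Choice.on liepres.

Definition lclass (t : lterm K X) : liepres := \pi_liepres t.

Lemma lclassP s t : lcongr rel s t -> lclass s = lclass t.
Proof. by move=> st; apply/eqmodP/asboolP. Qed.

Lemma lreprK x : lclass (repr x) = x.
Proof. exact: reprK. Qed.

Lemma lrepr_congr t : lcongr rel (repr (lclass t)) t.
Proof. by have /eqmodP/asboolP := lreprK (lclass t). Qed.

Definition lp_zero : liepres := lclass LZero.
Definition lp_add (x y : liepres) := lclass (LAdd (repr x) (repr y)).
Definition lp_opp (x : liepres) := lclass (LOpp (repr x)).
Definition lp_scale (a : K) (x : liepres) := lclass (LScale a (repr x)).
Definition lp_br (x y : liepres) := lclass (LBr (repr x) (repr y)).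

Lemma lclassD s t : lp_add (lclass s) (lclass t) = lclass (LAdd s t).
Proof. by apply/lclassP/lcongr_add; apply: lrepr_congr. Qed.

Lemma lclassN s : lp_opp (lclass s) = lclass (LOpp s).
Proof. by apply/lclassP/lcongr_opp; apply: lrepr_congr. Qed.

Lemma lclassZ a s : lp_scale a (lclass s) = lclass (LScale a s).
Proof. by apply/lclassP/lcongr_scale; apply: lrepr_congr. Qed.

Lemma lclassB s t : lp_br (lclass s) (lclass t) = lclass (LBr s t).
Proof. by apply/lclassP/lcongr_br; apply: lrepr_congr. Qed.

Definition lclassE := (lclassD, lclassN, lclassZ, lclassB).

Fact lp_addA : associative lp_add.
Proof.
move=> x y z; rewrite -[x]lreprK -[y]lreprK -[z]lreprK !lclassE.
exact/lclassP/lcongr_addA.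
Qed.

Fact lp_addC : commutative lp_add.
Proof.
by move=> x y; rewrite -[x]lreprK -[y]lreprK !lclassE; apply/lclassP/lcongr_addC.
Qed.

Fact lp_add0 : left_id lp_zero lp_add.
Proof. by move=> x; rewrite -[x]lreprK !lclassE; apply/lclassP/lcongr_add0. Qed.

Fact lp_addN : left_inverse lp_zero lp_opp lp_add.
Proof. by move=> x; rewrite -[x]lreprK !lclassE; apply/lclassP/lcongr_addN. Qed.

HB.instance Definition _ :=
  GRing.isZmodule.Build liepres lp_addA lp_addC lp_add0 lp_addN.

Fact lp_scaleA a b x : lp_scale a (lp_scale b x) = lp_scale (a * b) x.
Proof. by rewrite -[x]lreprK !lclassE; apply/lclassP/lcongr_scaleA. Qed.

Fact lp_scale1 : left_id 1 lp_scale.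
Proof. by move=> x; rewrite -[x]lreprK !lclassE; apply/lclassP/lcongr_scale1. Qed.

Fact lp_scaleDr : right_distributive lp_scale +%R.
Proof.
move=> a x y; rewrite -[x]lreprK -[y]lreprK.
rewrite /GRing.add /= !lclassE; exact/lclassP/lcongr_scaleDr.
Qed.

Fact lp_scaleDl x : {morph lp_scale^~ x : a b / a + b}.
Proof.
move=> a b; rewrite -[x]lreprK [in RHS]/GRing.add /= !lclassE.
exact/lclassP/lcongr_scaleDl.
Qed.

HB.instance Definition _ := GRing.Zmodule_isLmodule.Build K liepres
  lp_scaleA lp_scale1 lp_scaleDr lp_scaleDl.

Fact lp_br_linl y : linear (lp_br^~ y).
Proof.
move=> a x x'; rewrite -[x]lreprK -[x']lreprK -[y]lreprK.
rewrite /GRing.add /GRing.scale /= !lclassE; exact/lclassP/lcongr_br_linl.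
Qed.

Fact lp_br_linr x : linear (lp_br x).
Proof.
move=> a y y'; rewrite -[x]lreprK -[y]lreprK -[y']lreprK.
rewrite /GRing.add /GRing.scale /= !lclassE; exact/lclassP/lcongr_br_linr.
Qed.

Fact lp_brxx x : lp_br x x = 0.
Proof. by rewrite -[x]lreprK !lclassE; apply/lclassP/lcongr_brxx. Qed.

Fact lp_jacobi x y z :
  lp_br x (lp_br y z) + lp_br y (lp_br z x) + lp_br z (lp_br x y) = 0.
Proof.
rewrite -[x]lreprK -[y]lreprK -[z]lreprK /GRing.add /= !lclassE.
exact/lclassP/lcongr_jacobi.
Qed.

HB.instance Definition _ := Lmodule_isLie.Build K liepres
  lp_br_linl lp_br_linr lp_brxx lp_jacobi.

End PresentedLieAlgebra.

(* The module presented by generators Y and relations rel over G, built in the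
   same way. *)

Inductive mterm (K G Y : Type) : Type :=
| MGen of Y
| MZero
| MAdd of mterm K G Y & mterm K G Y
| MOpp of mterm K G Y
| MScale of K & mterm K G Y
| MAct of G & mterm K G Y.

Arguments MGen {K G Y} _.
Arguments MZero {K G Y}.
Arguments MScale {K G Y} _ _.
Arguments MAct {K G Y} _ _.

HB.instance Definition _ (K G Y : Type) := gen_eqMixin (mterm K G Y).
HB.instance Definition _ (K G Y : Type) := gen_choiceMixin (mterm K G Y).

Inductive mcongr (K : fieldType) (G : lieAlgType K) (Y : Type)
    (rel : mterm K G Y -> mterm K G Y -> Prop) :
    mterm K G Y -> mterm K G Y -> Prop :=
| mcongr_rel s t : rel s t -> mcongr rel s t
| mcongr_refl s : mcongr rel s s
| mcongr_sym s t : mcongr rel s t -> mcongr rel t s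
| mcongr_trans s t u : mcongr rel s t -> mcongr rel t u -> mcongr rel s u
| mcongr_add s s' t t' :
    mcongr rel s s' -> mcongr rel t t' -> mcongr rel (MAdd s t) (MAdd s' t')
| mcongr_opp s s' : mcongr rel s s' -> mcongr rel (MOpp s) (MOpp s')
| mcongr_scale a s s' :
    mcongr rel s s' -> mcongr rel (MScale a s) (MScale a s')
| mcongr_act x s s' :
    mcongr rel s s' -> mcongr rel (MAct x s) (MAct x s')
| mcongr_addA s t u :
    mcongr rel (MAdd s (MAdd t u)) (MAdd (MAdd s t) u)
| mcongr_addC s t : mcongr rel (MAdd s t) (MAdd t s)
| mcongr_add0 s : mcongr rel (MAdd MZero s) s
| mcongr_addN s : mcongr rel (MAdd (MOpp s) s) MZero
| mcongr_scaleA a b s :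
    mcongr rel (MScale a (MScale b s)) (MScale (a * b) s)
| mcongr_scale1 s : mcongr rel (MScale 1 s) s
| mcongr_scaleDr a s t :
    mcongr rel (MScale a (MAdd s t)) (MAdd (MScale a s) (MScale a t))
| mcongr_scaleDl s a b :
    mcongr rel (MScale (a + b) s) (MAdd (MScale a s) (MScale b s))
| mcongr_act_linl a x y s :
    mcongr rel (MAct (a *: x + y) s) (MAdd (MScale a (MAct x s)) (MAct y s))
| mcongr_act_linr x a s t :
    mcongr rel (MAct x (MAdd (MScale a s) t))
               (MAdd (MScale a (MAct x s)) (MAct x t))
| mcongr_act_lie x y s :
    mcongr rel (MAct (lie x y) s)
               (MAdd (MAct x (MAct y s)) (MOpp (MAct y (MAct x s)))).

Section PresentedModule.
Variables (K : fieldType) (G : lieAlgType K) (Y : Type).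
Variable rel : mterm K G Y -> mterm K G Y -> Prop.

Definition mcongrb : mterm K G Y -> mterm K G Y -> bool := fun s t => `[< mcongr rel s t >].

Lemma mcongrb_refl : reflexive mcongrb.
Proof. by move=> s; apply/asboolP/mcongr_refl. Qed.

Lemma mcongrb_sym : symmetric mcongrb.
Proof. by move=> s t; apply/asboolP/asboolP => /mcongr_sym. Qed.

Lemma mcongrb_trans : transitive mcongrb.
Proof.
by move=> t s u /asboolP st /asboolP tu; apply/asboolP/(mcongr_trans st tu).
Qed.

Canonical mcongrb_equiv :=
  EquivRel mcongrb mcongrb_refl mcongrb_sym mcongrb_trans.

Definition modpres : Type := {eq_quot mcongrb}.

HB.instance Definition _ := EqQuotient.on modpres.
HB.instance Definition _ := Choice.on modpres.

Definition mclass (t : mterm K G Y) : modpres := \pi_modpres t.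

Lemma mclassP s t : mcongr rel s t -> mclass s = mclass t.
Proof. by move=> st; apply/eqmodP/asboolP. Qed.

Lemma mreprK x : mclass (repr x) = x.
Proof. exact: reprK. Qed.

Lemma mrepr_congr t : mcongr rel (repr (mclass t)) t.
Proof. by have /eqmodP/asboolP := mreprK (mclass t). Qed.

Definition mp_zero : modpres := mclass MZero.
Definition mp_add (x y : modpres) := mclass (MAdd (repr x) (repr y)).
Definition mp_opp (x : modpres) := mclass (MOpp (repr x)).
Definition mp_scale (a : K) (x : modpres) := mclass (MScale a (repr x)).
Definition mp_act (g : G) (x : modpres) := mclass (MAct g (repr x)).

Lemma mclassD s t : mp_add (mclass s) (mclass t) = mclass (MAdd s t).
Proof. by apply/mclassP/mcongr_add; apply: mrepr_congr. Qed.

Lemma mclassN s : mp_opp (mclass s) = mclass (MOpp s).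
Proof. by apply/mclassP/mcongr_opp; apply: mrepr_congr. Qed.

Lemma mclassZ a s : mp_scale a (mclass s) = mclass (MScale a s).
Proof. by apply/mclassP/mcongr_scale; apply: mrepr_congr. Qed.

Lemma mclassA g s : mp_act g (mclass s) = mclass (MAct g s).
Proof. by apply/mclassP/mcongr_act; apply: mrepr_congr. Qed.

Definition mclassE := (mclassD, mclassN, mclassZ, mclassA).

Fact mp_addA : associative mp_add.
Proof.
move=> x y z; rewrite -[x]mreprK -[y]mreprK -[z]mreprK !mclassE.
exact/mclassP/mcongr_addA.
Qed.

Fact mp_addC : commutative mp_add.
Proof.
by move=> x y; rewrite -[x]mreprK -[y]mreprK !mclassE; apply/mclassP/mcongr_addC.
Qed.

Fact mp_add0 : left_id mp_zero mp_add.
Proof. by move=> x; rewrite -[x]mreprK !mclassE; apply/mclassP/mcongr_add0. Qed.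

Fact mp_addN : left_inverse mp_zero mp_opp mp_add.
Proof. by move=> x; rewrite -[x]mreprK !mclassE; apply/mclassP/mcongr_addN. Qed.

HB.instance Definition _ :=
  GRing.isZmodule.Build modpres mp_addA mp_addC mp_add0 mp_addN.

Fact mp_scaleA a b x : mp_scale a (mp_scale b x) = mp_scale (a * b) x.
Proof. by rewrite -[x]mreprK !mclassE; apply/mclassP/mcongr_scaleA. Qed.

Fact mp_scale1 : left_id 1 mp_scale.
Proof. by move=> x; rewrite -[x]mreprK !mclassE; apply/mclassP/mcongr_scale1. Qed.

Fact mp_scaleDr : right_distributive mp_scale +%R.
Proof.
move=> a x y; rewrite -[x]mreprK -[y]mreprK.
rewrite /GRing.add /= !mclassE; exact/mclassP/mcongr_scaleDr.
Qed.

Fact mp_scaleDl x : {morph mp_scale^~ x : a b / a + b}.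
Proof.
move=> a b; rewrite -[x]mreprK [in RHS]/GRing.add /= !mclassE.
exact/mclassP/mcongr_scaleDl.
Qed.

HB.instance Definition _ := GRing.Zmodule_isLmodule.Build K modpres
  mp_scaleA mp_scale1 mp_scaleDr mp_scaleDl.

Fact mp_act_linl v : linear (mp_act^~ v).
Proof.
move=> a x y; rewrite -[v]mreprK [in RHS]/GRing.add [in RHS]/GRing.scale /=.
by rewrite !mclassE; apply/mclassP/mcongr_act_linl.
Qed.

Fact mp_act_linr x : linear (mp_act x).
Proof.
move=> a v w; rewrite -[v]mreprK -[w]mreprK.
rewrite /GRing.add /GRing.scale /= !mclassE; exact/mclassP/mcongr_act_linr.
Qed.

Fact mp_act_lie x y v :
  mp_act (lie x y) v = mp_act x (mp_act y v) - mp_act y (mp_act x v).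
Proof.
rewrite -[v]mreprK [in RHS]/GRing.add [in RHS]/GRing.opp /= !mclassE.
exact/mclassP/mcongr_act_lie.
Qed.

HB.instance Definition _ := Lmodule_isLieModule.Build K G modpres
  mp_act_linl mp_act_linr mp_act_lie.

End PresentedModule.

Definition bkm_cartan_matrix (R : realType) (I : finType) (A : I -> I -> R) :=
  [/\ forall i, A i i = 2 \/ A i i <= 0,
      forall i j, A i j = 0 <-> A j i = 0,
      forall i j, i != j -> A i j <= 0
    & forall i j, A i i = 2 -> j != i -> exists n : nat, A i j = - n%:R].

Definition Ipos (R : realType) (I : finType) (A : I -> I -> R) : {set I} :=
  [set i | A i i == 2]%SET.
Definition Izero (R : realType) (I : finType) (A : I -> I -> R) : {set I} :=
  [set i | A i i == 0]%SET.
Definition Ineg (R : realType) (I : finType) (A : I -> I -> R) : {set I} :=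
  [set i | A i i < 0]%SET.

Definition matrix_of (R : realType) (I : finType) (A : I -> I -> R) :
    'M[R]_#|I| :=
  \matrix_(i, j) A (enum_val i) (enum_val j).

(* (cartan, sroot, coroot) is the triple (h, Pi, Pi^vee); #|I| - \rank A is the
   nullity of A. *)
Record realization (R : realType) (I : finType) (A : I -> I -> R) := Realization {
  cartan : vectType R[i];
  sroot : I -> 'Hom(cartan, R[i]^o);
  coroot : I -> cartan;
  dim_cartan :
    \dim {: cartan} = (#|I| + (#|I| - \rank (matrix_of A)))%N;
  sroot_free : free [seq sroot i | i : I];
  coroot_free : free [seq coroot i | i : I];
  sroot_coroot : forall i j, sroot j (coroot i) = (A i j)%:C
}.

Definition dual_cartan (R : realType) (I : finType) (A : I -> I -> R)
  (D : realization A) := 'Hom(cartan D, R[i]^o).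

Inductive bkm_gen (I h : Type) : Type :=
| Ge of I
| Gf of I
| Gh of h.

Arguments Ge {I h} _.
Arguments Gf {I h} _.
Arguments Gh {I h} _.

Section BKM.
Variables (R : realType) (I : finType) (A : I -> I -> R) (D : realization A).

Local Notation term := (lterm R[i] (bkm_gen I (cartan D))).
Local Notation e i := (LGen (Ge i) : term).
Local Notation f i := (LGen (Gf i) : term).
Local Notation "''h' x" := (LGen (Gh x) : term) (at level 8, x at level 2).

(* bkm_h_lin makes the generators Gh x the image of a linear map from h.
   In the Serre relations n stands for - A i j. *)
Inductive bkm_rel : term -> term -> Prop :=
| bkm_h_lin a (x y : cartan D) :
    bkm_rel 'h (a *: x + y) (LAdd (LScale a 'h x) 'h y)
| bkm_hh (x y : cartan D) : bkm_rel (LBr 'h x 'h y) LZero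
| bkm_he (x : cartan D) i :
    bkm_rel (LBr 'h x (e i)) (LScale (sroot D i x) (e i))
| bkm_hf (x : cartan D) i :
    bkm_rel (LBr 'h x (f i)) (LScale (- sroot D i x) (f i))
| bkm_ef i : bkm_rel (LBr (e i) (f i)) 'h (coroot D i)
| bkm_ef0 i j : i != j -> bkm_rel (LBr (e i) (f j)) LZero
| bkm_serre_e i j (n : nat) : i \in Ipos A -> j != i -> A i j = - n%:R ->
    bkm_rel (iter n.+1 (LBr (e i)) (e j)) LZero
| bkm_serre_f i j (n : nat) : i \in Ipos A -> j != i -> A i j = - n%:R ->
    bkm_rel (iter n.+1 (LBr (f i)) (f j)) LZero
| bkm_ee i j : A i j = 0 -> bkm_rel (LBr (e i) (e j)) LZero
| bkm_ff i j : A i j = 0 -> bkm_rel (LBr (f i) (f j)) LZero.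

Definition bkm : lieAlgType R[i] := liepres bkm_rel.

Definition bkm_e (i : I) : bkm := lclass bkm_rel (e i).
Definition bkm_f (i : I) : bkm := lclass bkm_rel (f i).
Definition bkm_h (x : cartan D) : bkm := lclass bkm_rel 'h x.

Local Notation hdual := (dual_cartan D).

Definition wt_space (V : lieModType bkm) (mu : hdual) : set V :=
  [set v | forall x, act (bkm_h x) v = mu x *: v]%classic.

Definition wt (V : lieModType bkm) : set hdual :=
  [set mu | exists2 v : V, wt_space mu v & v != 0]%classic.

(* Since n^+ is generated by the e_i, this is U(g) modulo the left ideal
   generated by n^+ and the elements x - lam(x), x in h. *)
Inductive verma_rel (lam : hdual) :
    mterm R[i] bkm unit -> mterm R[i] bkm unit -> Prop :=
| verma_e i : verma_rel lam (MAct (bkm_e i) (MGen tt)) MZero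
| verma_h x :
    verma_rel lam (MAct (bkm_h x) (MGen tt)) (MScale (lam x) (MGen tt)).

Definition verma (lam : hdual) : lieModType bkm := modpres (verma_rel lam).

Definition nonzero_module (V : lieModType bkm) := exists v : V, v != 0.

Definition is_quotient (M V : lieModType bkm) :=
  exists p : {linear M -> V},
    (forall x m, p (act x m) = act x (p m)) /\ (forall v, exists m, p m = v).

Definition highest_weight_module (lam : hdual) (V : lieModType bkm) :=
  nonzero_module V /\ is_quotient (verma lam) V.

Definition submodule (V : lieModType bkm) (N : set V) :=
  [/\ N 0, forall a v w, N v -> N w -> N (a *: v + w)
    & forall x v, N v -> N (act x v)].

Definition simple_module (V : lieModType bkm) :=
  nonzero_module V /\
  forall N : set V, submodule N -> (N = [set 0] \/ N = setT)%classic.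

(* The simple quotient L(lam) of M(lam), up to isomorphism. *)
Definition simple_highest_weight_module (lam : hdual) (V : lieModType bkm) :=
  highest_weight_module lam V /\ simple_module V.

Definition srefl (i : I) (mu : hdual) : hdual :=
  mu - mu (coroot D i) *: sroot D i.

(* The subgroup generated by the s_i with i in K; inverses come for free since
   the s_i are involutions. *)
Inductive weyl (K : set I) : (hdual -> hdual) -> Prop :=
| weyl_id : weyl K idfun
| weyl_srefl i w : K i -> weyl K w -> weyl K (srefl i \o w).

Definition lincomb (c : I -> nat) : hdual := \sum_i (c i)%:R *: sroot D i.

Definition wt_le (mu lam : hdual) := exists c : I -> nat, lam - mu = lincomb c.

Definition independent (H : {set I}) :=
  forall i j, i \in H -> j \in H -> i != j -> A i j = 0.

Definition dynkin_in (J : {set I}) : rel I :=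
  [rel i j | [&& i \in J, j \in J, i != j & A i j != 0]].

Definition components (J : {set I}) : {set {set I}} :=
  equivalence_partition (connect (dynkin_in J)) J.

Definition J_set (lam : hdual) : set I :=
  [set i | exists n : nat, lam (coroot D i) = (A i i)%:C / 2 * n%:R]%classic.

Definition I_V (lam : hdual) (V : lieModType bkm) : set I :=
  [set i | i \in Ipos A /\ exists2 n : nat, lam (coroot D i) = n%:R &
     forall v : V, wt_space lam v -> iter n.+1 (act (bkm_f i)) v = 0]%classic.

(* The order of the factors is immaterial when H is independent. *)
Definition fprod (V : lieModType bkm) (H : {set I}) (m : I -> nat) (v : V) : V :=
  foldr (fun h w => iter (m h) (act (bkm_f h)) w) v (enum H).

(* A function H -> nat is encoded as its extension by 0 to I. *)
Definition hole (lam : hdual) (V : lieModType bkm)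
    (p : {set I} * {ffun I -> nat}) :=
  let: (H, m) := p in
  [/\ [/\ H != finset.set0, forall h, h \in H -> J_set lam h & independent H],
      [/\ forall h, h \notin H -> m h = 0%N,
          forall h, h \in H -> h \in Ipos A :|: Ineg A ->
            (m h)%:R = 2 / (A h h)%:C * lam (coroot D h) + 1
        & forall h, h \in H -> h \in Izero A -> (1 <= m h)%N]%SET
    & forall v : V, wt_space lam v -> fprod H m v = 0].

Definition minimal_hole (lam : hdual) (V : lieModType bkm)
    (p : {set I} * {ffun I -> nat}) :=
  hole lam V p /\
  ~ exists q, [/\ hole lam V q, q <> p, q.1 \subset p.1
                & forall j, j \in q.1 -> (q.2 j <= p.2 j)%N].

Definition nice (lam : hdual) (V : lieModType bkm) :=
  forall p, minimal_hole lam V p ->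
    p.1 \subset (Ineg A :|: Izero A)%SET \/
    (p.1 \subset Ipos A /\ #|p.1| = 1%N).

Definition condC1 (lam : hdual) (V : lieModType bkm) (mu : hdual) :=
  forall i, I_V lam V i -> exists n : nat, mu (coroot D i) = n%:R.

(* jk chooses a node in each component; J is supp(lam - mu). *)
Definition condC2 (lam : hdual) (V : lieModType bkm) (mu : hdual) :=
  mu <> lam ->
  exists c : I -> nat, mu = lam - lincomb c /\
    let J := [set j | c j != 0%N]%SET in
    exists jk : {set I} -> I,
      (forall C, C \in components J -> jk C \in C) /\
      wt V (lam - \sum_(C in components J | #|C| == 1%N)
                     (c (jk C))%:R *: sroot D (jk C)
                - \sum_(C in components J | (1 < #|C|)%N) sroot D (jk C)).

End BKM.

(* Main.v *)
From HB Require Import structures.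
Require Import Defs.
From mathcomp Require Import all_boot all_order all_algebra.
From mathcomp Require Import boolp classical_sets reals complex.
From mathcomp Require Import finset zify ring.

(* Call c : I -> nat a weight content when lam - sum_i c_i alpha_i is a weight
   of V, that is, when some word in the f_i with c_i letters f_i does not kill
   the highest weight vector v0.

   If m is a weight content and m + alpha_i is not, then applying e_i to a
   vanishing word w f_i^(k+1) v0 with k maximal gives lam(h_i) = k A_ii / 2, and
   following the e_i-string of a nonzero vector killed by f_i gives
   sum_j m_j A_ij = (k + k') A_ii / 2, with k, k' <= m_i.  By the signs in A,
   when A_ii <= 0 or m_i = 0 this forces i to have no neighbour in supp m.
   It follows that a minimal non-weight content is a minimal hole.

   For the inclusion from right to left, let mu = lam - sum_i c_i alpha_i satisfy
   (C1) and (C2), let mu' have content s, and replace s by c at the real nodes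
   outside I_V; since the hole-set is nice, the result n is still a weight
   content.  Let m be a maximal weight content with n <= m <= c.  Then m has full
   support, and m_i < c_i only for i in I_V.  For such i, (C1) gives
   sum_j (c - m)_j A_ij <= 0 <= sum_j m_j A_ij.  Comparing at an i where
   (c - m)_i / m_i is largest, both are equalities, and this propagates to the
   whole component of i, on which lam(h_j) = 0 for nodes j in I_V; so f_j v0 = 0
   there, which contradicts (C2).

   For the other inclusion, every weight satisfies (C2): letters in different
   components commute, so from a nonzero word one can move to the right the last
   letter of each component.  The rest is the W_{I_V}-invariance of wt V and an
   induction on the height of lam - mu.

   In a simple module the singular vectors f_i^m v0 (i in H) of a hole vanish, so
   that minimal holes are singletons. *)

Set Implicit Arguments.
Unset Strict Implicit.
Unset Printing Implicit Defensive.

Import Order.TTheory GRing.Theory Num.Theory.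
Local Open Scope complex_scope.
Local Open Scope ring_scope.

(** * Words in the lowering operators *)

HB.instance Definition _ (K : fieldType) (G : lieAlgType K) (V : lieModType G)
  (x : G) := GRing.isLinear.Build K V V *:%R (act x) (act_linr x).

Section LinearSpan.
Variables (K : fieldType) (V : lmodType K).

Inductive lspan (P : V -> Prop) : V -> Prop :=
| lspan0 : lspan P 0
| lspanS a u v : P u -> lspan P v -> lspan P (a *: u + v).

Lemma lspan_sub P u : P u -> lspan P u.
Proof.
move=> Pu; rewrite -[u]addr0 -[u]scale1r.
by apply: lspanS => //; apply: lspan0.
Qed.

Lemma lspanD P u v : lspan P u -> lspan P v -> lspan P (u + v).
Proof.
move=> Pu Pv; elim: Pu => [|a x y Px _ IH]; first by rewrite add0r.
by rewrite -addrA; apply: lspanS.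
Qed.

Lemma lspanZ P a u : lspan P u -> lspan P (a *: u).
Proof.
elim=> [|b x y Px _ IH]; first by rewrite scaler0; apply: lspan0.
by rewrite scalerDr scalerA; apply: lspanS.
Qed.

Lemma lspan_eq0 P u : (forall x, P x -> x = 0) -> lspan P u -> u = 0.
Proof. by move=> P0; elim=> [//|a x y /P0-> _ ->]; rewrite scaler0 addr0. Qed.

End LinearSpan.

Lemma lspan_map (K : fieldType) (V W : lmodType K) (g : {linear V -> W})
    (P : V -> Prop) (Q : W -> Prop) u :
  (forall x, P x -> lspan Q (g x)) -> lspan P u -> lspan Q (g u).
Proof.
move=> PQ; elim=> [|a x y /PQ Qx _ IH]; first by rewrite linear0; apply: lspan0.
by rewrite linearP; apply: lspanD => //; apply: lspanZ.
Qed.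

Section BKMAction.
Variables (R : realType) (I : finType) (A : I -> I -> R) (D : realization A).
Variable V : lieModType (bkm D).

Local Notation e i := (act (bkm_e D i)).
Local Notation f i := (act (bkm_f D i)).
Local Notation h x := (act (bkm_h (D := D) x)).
Local Notation rel := (@bkm_rel R I A D).

Lemma lie_lclass (s t : lterm R[i] (bkm_gen I (cartan D))) :
  lie (lclass rel s : bkm D) (lclass rel t) =
  lclass rel (LBr s t).
Proof. exact: lclassB. Qed.

Lemma lclass_rel (s t : lterm R[i] (bkm_gen I (cartan D))) :
  rel s t -> lclass rel s = lclass rel t :> bkm D.
Proof. by move=> st; apply/lclassP/lcongr_rel. Qed.

Lemma lie_ef i j :
  lie (bkm_e D i) (bkm_f D j) = if i == j then bkm_h (coroot D i) else 0.
Proof.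
rewrite lie_lclass; case: eqVneq => [<-|ij].
  exact/lclass_rel/bkm_ef.
exact/lclass_rel/bkm_ef0.
Qed.

Lemma lie_he x i : lie (bkm_h x) (bkm_e D i) = sroot D i x *: bkm_e D i.
Proof.
rewrite lie_lclass (lclass_rel (bkm_he _ _)); apply/esym.
exact: lclassZ.
Qed.

Lemma lie_hf x i : lie (bkm_h x) (bkm_f D i) = - sroot D i x *: bkm_f D i.
Proof.
rewrite lie_lclass (lclass_rel (bkm_hf _ _)); apply/esym.
exact: lclassZ.
Qed.

Lemma lie_ff i j : A i j = 0 -> lie (bkm_f D i) (bkm_f D j) = 0.
Proof. by move=> Aij; rewrite lie_lclass; apply/lclass_rel/bkm_ff. Qed.

Lemma lie_serre_f i j (n : nat) : i \in Ipos A -> j != i -> A i j = - n%:R ->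
  iter n.+1 (lie (bkm_f D i)) (bkm_f D j) = 0.
Proof.
move=> ip ji Aij.
have iterE k : iter k (lie (bkm_f D i)) (bkm_f D j) =
  lclass rel (iter k (LBr (LGen (Gf i))) (LGen (Gf j))).
  by elim: k => //= k ->; rewrite lie_lclass.
by rewrite iterE; apply/lclass_rel/bkm_serre_f.
Qed.

Lemma act0l (v : V) : act (0 : bkm D) v = 0.
Proof.
have := act_linl v (-1) (0 : bkm D) (0 : bkm D).
by rewrite !scaleN1r oppr0 addr0 addNr.
Qed.

Lemma actZl a (x : bkm D) (v : V) : act (a *: x) v = a *: act x v.
Proof. by have := act_linl v a x (0 : bkm D); rewrite addr0 act0l addr0. Qed.

Lemma actDl (x y : bkm D) (v : V) : act (x + y) v = act x v + act y v.
Proof. by have := act_linl v 1 x y; rewrite !scale1r. Qed.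

Lemma act_swap (x y : bkm D) (v : V) :
  act x (act y v) = act y (act x v) + act (lie x y) v.
Proof. by rewrite act_lie addrC subrK. Qed.

Lemma act_ef i j (v : V) :
  e i (f j v) = f j (e i v) + (if i == j then h (coroot D i) v else 0).
Proof. by rewrite act_swap lie_ef; case: eqP => // _; rewrite act0l. Qed.

Lemma act_he x i (v : V) : h x (e i v) = e i (h x v) + sroot D i x *: e i v.
Proof. by rewrite act_swap lie_he actZl. Qed.

Lemma act_hf x i (v : V) : h x (f i v) = f i (h x v) - sroot D i x *: f i v.
Proof. by rewrite act_swap lie_hf actZl scaleNr. Qed.

Lemma act_ff i j (v : V) : (i != j -> A i j = 0) -> f i (f j v) = f j (f i v).
Proof.
case: eqVneq => [->//|_ /(_ isT) Aij].
by rewrite act_swap lie_ff// act0l addr0.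
Qed.

Lemma wt_space_e mu i (v : V) :
  wt_space mu v -> wt_space (mu + sroot D i) (e i v).
Proof. by move=> mv x; rewrite act_he mv linearZ /= lfunE /= scalerDl. Qed.

Lemma wt_space_f mu i (v : V) :
  wt_space mu v -> wt_space (mu - sroot D i) (f i v).
Proof.
by move=> mv x; rewrite act_hf mv linearZ /= !lfunE /= lfunE /= scalerBl.
Qed.

Lemma wt_spaceZ mu a (v : V) : wt_space mu v -> wt_space mu (a *: v).
Proof. by move=> mv x; rewrite linearZ /= mv !scalerA mulrC. Qed.

Lemma wt_spaceD mu (u v : V) :
  wt_space mu u -> wt_space mu v -> wt_space mu (u + v).
Proof. by move=> mu_u mv x; rewrite linearD /= mu_u mv scalerDr. Qed.

(* A vector of weight mu is separated from the weight nu by any x with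
   mu x <> nu x: apply (x - nu x) / (mu x - nu x). *)
Lemma wt_space_indep mu (Q : V -> Prop) v :
  (forall u, Q u -> exists2 nu, wt_space nu u & nu <> mu) ->
  lspan Q v -> wt_space mu v -> v = 0.
Proof.
move=> Qw vspan.
have [s [sQ ->]] : exists s : seq V,
    (forall u, u \in s -> exists2 nu, wt_space nu u & nu <> mu) /\
    v = \sum_(u <- s) u.
  elim: vspan => [|a x y Qx _ [s [sQ ->]]]; first by exists [::]; rewrite big_nil.
  exists (a *: x :: s); rewrite big_cons; split=> // u.
  rewrite inE => /orP[/eqP->|/sQ//]; have [nu nux numu] := Qw _ Qx.
  by exists nu => //; apply: wt_spaceZ.
have [n] := ubnP (size s); elim: n s sQ => [|n IH] [|u s] //=.
  by rewrite big_nil.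
rewrite ltnS => sQ ssz; rewrite big_cons => uw.
have [nu nuu numu] := sQ u (mem_head _ _).
have [x xd] : exists x, mu x != nu x.
  apply: contrapT => nx; apply: numu; apply/lfunP => x.
  by apply/eqP/negPn/negP => xd; apply: nx; exists x; rewrite eq_sym.
have d0 : mu x - nu x != 0 by rewrite subr_eq0.
pose g (w : V) := (mu x - nu x)^-1 *: (h x w - nu x *: w).
have gD : {morph g : a b / a + b}.
  move=> a b; rewrite /g -scalerDr (linearD (act (bkm_h x))) (scalerDr (nu x)).
  by rewrite opprD addrACA.
have g0 : g 0 = 0 by rewrite /g linear0 scaler0 subr0 scaler0.
have gE : u + \sum_(w <- s) w = \sum_(w <- map g s) w.
  rewrite big_map; have <- : g (u + \sum_(w <- s) w) = u + \sum_(w <- s) w.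
    by rewrite {1}/g uw -scalerBl scalerA mulVf // scale1r.
  rewrite gD (big_morph g gD g0).
  by rewrite {1}/g nuu subrr scaler0 add0r.
rewrite gE; apply: IH; rewrite ?size_map //; last by rewrite -gE.
move=> _ /mapP[w ws ->]; have [|nu' nuw num] := sQ w; first by rewrite inE ws orbT.
exists nu' => //; rewrite /g; apply: wt_spaceZ; rewrite nuw -scalerBl.
exact: wt_spaceZ.
Qed.

Definition fword (w : seq I) (v : V) : V := foldr (fun i => f i) v w.

Lemma fword_cat w1 w2 v : fword (w1 ++ w2) v = fword w1 (fword w2 v).
Proof. exact: foldr_cat. Qed.

Lemma fword_is_linear w : linear (fword w).
Proof.
elim: w => [//|i w IH] a u v.
by rewrite -[LHS]/(f i (fword w (a *: u + v))) IH linearP.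
Qed.

HB.instance Definition _ w :=
  GRing.isLinear.Build R[i] V V *:%R (fword w) (fword_is_linear w).

Lemma fword_nseq n i v : fword (nseq n i) v = iter n (f i) v.
Proof. by elim: n => //= n ->. Qed.

Lemma fword_neq0 w v : fword w v != 0 -> v != 0.
Proof. by apply: contra => /eqP->; rewrite linear0. Qed.

Definition wsum (w : seq I) : dual_cartan D := \sum_(i <- w) sroot D i.

Lemma wsum_cat w1 w2 : wsum (w1 ++ w2) = wsum w1 + wsum w2.
Proof. exact: big_cat. Qed.

Lemma wt_space_fword mu w v :
  wt_space mu v -> wt_space (mu - wsum w) (fword w v).
Proof.
move=> mv; elim: w => [|i w IH] /=; first by rewrite /wsum big_nil subr0.
by rewrite /wsum big_cons opprD addrA addrAC; apply: wt_space_f.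
Qed.

Lemma f_fword_comm i w v : (forall j, j \in w -> i != j -> A i j = 0) ->
  f i (fword w v) = fword w (f i v).
Proof.
elim: w => //= j w IH iw; rewrite act_ff; last by apply: iw; rewrite mem_head.
by rewrite IH// => k kw; apply: iw; rewrite inE kw orbT.
Qed.

Lemma fword_comm w1 w2 v :
  (forall i j, i \in w1 -> j \in w2 -> A i j = 0) ->
  fword (w1 ++ w2) v = fword (w2 ++ w1) v.
Proof.
rewrite !fword_cat; elim: w1 => //= i w1 IH w12; rewrite IH; last first.
  by move=> k j kw; apply: w12; rewrite inE kw orbT.
by rewrite f_fword_comm// => j jw _; apply: w12; rewrite ?mem_head.
Qed.

Lemma fword_filter (a : pred I) w v :
  (forall i j, i \in w -> j \in w -> ~~ a i -> a j -> A i j = 0) ->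
  fword w v = fword (filter a w ++ filter (predC a) w) v.
Proof.
elim: w => //= i w IH wC; rewrite IH; last first.
  by move=> k l kw lw; apply: wC; rewrite inE ?kw ?lw orbT.
case: ifP => [ai|/negbT ai] //=; rewrite !fword_cat /= f_fword_comm // => j.
rewrite mem_filter => /andP[aj jw] _.
by apply: wC => //; rewrite inE ?eqxx// jw orbT.
Qed.

Lemma fword_perm w1 w2 v :
  (forall i j, i \in w1 -> j \in w1 -> i != j -> A i j = 0) ->
  perm_eq w1 w2 -> fword w1 v = fword w2 v.
Proof.
elim: w2 w1 => [|j w2 IH] w1 w1C; first by move/perm_nilP->.
move=> w12; have jw1 : j \in w1 by rewrite (perm_mem w12) mem_head.
case/splitPr: jw1 w12 w1C => p1 p2 w12 w1C.
have sub k : k \in p1 ++ p2 -> k \in p1 ++ j :: p2.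
  by rewrite !mem_cat inE => /orP[]->; rewrite ?orbT.
rewrite -[RHS]/(f j (fword w2 v)) -(IH (p1 ++ p2)); last 2 first.
- by move=> k l /sub kp /sub lp; apply: w1C.
- rewrite -(perm_cons j); apply: perm_trans w12; rewrite perm_sym.
  exact/permPl/(perm_catCA p1 [:: j] p2).
rewrite !fword_cat /= -f_fword_comm // => k kp.
by apply: w1C; rewrite mem_cat ?kp // mem_head orbT.
Qed.

End BKMAction.

(** * Strings and singular vectors *)

Section Strings.
Variables (R : realType) (I : finType) (A : I -> I -> R) (D : realization A).
Variable V : lieModType (bkm D).

Local Notation e i := (act (bkm_e D i)).
Local Notation f i := (act (bkm_f D i)).
Local Notation h x := (act (bkm_h (D := D) x)).
Local Notation word_span P x :=
  (lspan (fun u => exists2 w : seq I, P w & u = fword w x)).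

Lemma wt_space_iter_f mu i n (v : V) :
  wt_space mu v -> wt_space (mu - n%:R *: sroot D i) (iter n (f i) v).
Proof.
move=> mv; elim: n => [|n IH]; first by rewrite scale0r subr0.
by rewrite -natr1 scalerDl scale1r opprD addrA; apply: wt_space_f.
Qed.

Lemma wt_space_iter_e mu i n (v : V) :
  wt_space mu v -> wt_space (mu + n%:R *: sroot D i) (iter n (e i) v).
Proof.
move=> mv; elim: n => [|n IH]; first by rewrite scale0r addr0.
by rewrite -natr1 scalerDl scale1r addrA; apply: wt_space_e.
Qed.

Lemma e_iter_f mu i n (v : V) : wt_space mu v -> e i v = 0 ->
  e i (iter n.+1 (f i) v) =
  (n.+1%:R * (mu (coroot D i) - n%:R * (A i i)%:C / 2)) *: iter n (f i) v.
Proof.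
move=> mv ev; elim: n => [|n IH].
  rewrite /= act_ef eqxx ev linear0 add0r mv; congr (_ *: _).
  by rewrite !mul0r subr0 mul1r.
rewrite [in LHS]iterS act_ef eqxx IH linearZ /=.
rewrite (wt_space_iter_f i n.+1 mv) -scalerDl; congr (_ *: _).
rewrite lfunE /= lfunE /= lfunE /= sroot_coroot -!natr1 /GRing.scale /=.
by field.
Qed.

Lemma f_iter_e mu i n (v : V) : wt_space mu v -> f i v = 0 ->
  f i (iter n.+1 (e i) v) =
  - (n.+1%:R * (mu (coroot D i) + n%:R * (A i i)%:C / 2)) *: iter n (e i) v.
Proof.
move=> mv fv.
have fe (u : V) : f i (e i u) = e i (f i u) - h (coroot D i) u.
  by rewrite act_ef eqxx addrK.
elim: n => [|n IH].
  rewrite /= fe fv linear0 sub0r mv -scaleNr; congr (- _ *: _).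
  by rewrite !mul0r addr0 mul1r.
rewrite [in LHS]iterS fe IH linearZ /=.
rewrite (wt_space_iter_e i n.+1 mv) -scalerBl; congr (_ *: _).
rewrite lfunE /= lfunE /= sroot_coroot -!natr1 /GRing.scale /=.
by field.
Qed.

Lemma e_fword mu i w (x : V) : wt_space mu x ->
  word_span (fun t => perm_eq (i :: t) w) x (e i (fword w x) - fword w (e i x)).
Proof.
move=> mx; elim: w => [|j w IH]; first by rewrite subrr; apply: lspan0.
rewrite -[fword _ x]/(f j (fword w x)) -[fword _ (e i x)]/(f j (fword w (e i x))).
rewrite act_ef addrAC -linearB /=; apply: lspanD.
  apply: lspan_map IH => _ [t tw ->]; apply: lspan_sub; exists (j :: t) => //.
  by rewrite -[_ :: w](cat1s j w) -(cat1s i) -(cat1s j t) perm_catCA perm_cat2l.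
case: eqVneq => [<-|_]; last exact: lspan0.
rewrite (wt_space_fword w mx); apply/lspanZ/lspan_sub.
by exists w.
Qed.

Lemma iter_e_fword mu i n w (x : V) : wt_space mu x -> e i x = 0 ->
  word_span (fun t => perm_eq (nseq n i ++ t) w) x (iter n (e i) (fword w x)).
Proof.
move=> mx ex; elim: n => [|n IH]; first by apply: lspan_sub; exists w.
rewrite iterS; apply: lspan_map IH => _ [t tw ->].
have := e_fword i t mx; rewrite ex linear0 subr0.
apply: (@lspan_map _ _ _ idfun) => _ [t' t't ->]; apply: lspan_sub; exists t' => //.
apply: perm_trans tw; apply: perm_trans (perm_cat (perm_refl (nseq n i)) t't).
by rewrite perm_sym; apply/permPl/(perm_catCA (nseq n i) [:: i] t').
Qed.

Lemma singular_span_act mu (x : V) : wt_space mu x -> (forall i, e i x = 0) ->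
  forall g v, word_span (fun=> True) x v -> word_span (fun=> True) x (act g v).
Proof.
move=> mx ex g; rewrite -[g]lreprK.
elim: (repr g) => {g} [[i|i|y]||s IHs t IHt|s IHs|a s IHs|s IHs t IHt] v vS.
- apply: lspan_map vS => _ [w _ ->].
  have := e_fword i w mx; rewrite ex linear0 subr0.
  by apply: (@lspan_map _ _ _ idfun) => _ [t _ ->]; apply: lspan_sub; exists t.
- by apply: lspan_map vS => _ [w _ ->]; apply: lspan_sub; exists (i :: w).
- apply: lspan_map vS => _ [w _ ->].
  rewrite /= -[act _ _]/(h y (fword w x)) (wt_space_fword w mx).
  by apply/lspanZ/lspan_sub; exists w.
- by rewrite -[lclass _ _]/(0 : bkm D) act0l; apply: lspan0.
- rewrite -lclassD -[lp_add _ _]/(lclass _ s + lclass _ t : bkm D) actDl.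
  by apply: lspanD; [apply: IHs|apply: IHt].
- rewrite -lclassN -[lp_opp _]/(- (lclass _ s : bkm D)) -scaleN1r actZl.
  exact/lspanZ/IHs.
- rewrite -lclassZ -[lp_scale _ _]/(a *: (lclass _ s : bkm D)) actZl.
  exact/lspanZ/IHs.
rewrite -lclassB -[lp_br _ _]/(lie (lclass _ s : bkm D) (lclass _ t)) act_lie.
rewrite -scaleN1r; apply: lspanD; first exact/IHs/IHt.
exact/lspanZ/IHt/IHs.
Qed.

End Strings.

(** * Weights and contents *)

Section Contents.
Variable I : finType.
Implicit Types (m c d : {ffun I -> nat}) (w : seq I).

Definition cont w : {ffun I -> nat} := [ffun i => count_mem i w].
Definition incr m i : {ffun I -> nat} := [ffun j => m j + (j == i)]%N.
Definition cle c d := [forall i, (c i <= d i)%N].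

Lemma incrE m i j : incr m i j = (m j + (j == i))%N.
Proof. exact: ffunE. Qed.

Lemma cle_refl c : cle c c. Proof. exact/forallP. Qed.

Lemma cle_trans d c c' : cle c d -> cle d c' -> cle c c'.
Proof.
move=> /forallP cd /forallP dc; apply/forallP => i.
exact: leq_trans (cd i) _.
Qed.

Lemma cont_cat w1 w2 i : cont (w1 ++ w2) i = (cont w1 i + cont w2 i)%N.
Proof. by rewrite !ffunE count_cat. Qed.

Lemma cont_cons w i : cont (i :: w) = incr (cont w) i.
Proof. by apply/ffunP => j; rewrite !ffunE /= addnC eq_sym. Qed.

Lemma cont_nseq n i j : cont (nseq n i) j = (n * (i == j))%N.
Proof. by rewrite ffunE count_nseq mulnC. Qed.

Lemma cont_perm w1 w2 : (cont w1 == cont w2) = perm_eq w1 w2.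
Proof.
apply/eqP/idP => [w12|/permP w12]; last by apply/ffunP => i; rewrite !ffunE w12.
by apply/allP => i _; apply/eqP; move/ffunP/(_ i): w12; rewrite !ffunE.
Qed.

Lemma cont_gt0 w i : (0 < cont w i)%N = (i \in w).
Proof. by rewrite ffunE -has_count has_pred1. Qed.

Definition word_of c : seq I := flatten [seq nseq (c i) i | i <- enum I].

Lemma word_ofK c : cont (word_of c) = c.
Proof.
apply/ffunP => i; rewrite ffunE /word_of count_flatten -map_comp sumnE big_map.
rewrite big_enum (bigD1 i) //= count_nseq /= eqxx mul1n big1 ?addn0 // => j ji.
by rewrite count_nseq /= (negbTE ji).
Qed.

Lemma sum_lt c d : cle c d -> c <> d -> (\sum_i c i < \sum_i d i)%N.
Proof.
move=> /forallP cd cNd; rewrite ltn_neqAle leq_sum ?andbT//.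
apply/negP => /eqP s; apply: cNd; apply/ffunP => i; apply/eqP; rewrite eqn_leq cd /=.
have : (\sum_j (d j - c j) == 0)%N by rewrite sumnB ?s ?subnn.
by rewrite sum_nat_eq0 => /forallP/(_ i); rewrite subn_eq0.
Qed.

Lemma exists_minimal (P : {ffun I -> nat} -> Prop) c : P c ->
  exists d, [/\ cle d c, P d & forall d', cle d' d -> d' <> d -> ~ P d'].
Proof.
have [n] := ubnP (\sum_i c i); elim: n c => // n IH c; rewrite ltnS => cn Pc.
have [[d [dc dNc Pd]]|nd] := pselect (exists d, [/\ cle d c, d <> c & P d]).
  have [|d' [d'd Pd' min]] := IH d _ Pd; first by apply: leq_trans cn; apply: sum_lt.
  by exists d'; split=> //; apply: cle_trans dc.
by exists c; split; rewrite ?cle_refl // => d dc dNc Pd; apply: nd; exists d.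
Qed.

Lemma exists_maximal (P : {ffun I -> nat} -> Prop) n c : cle n c -> P n ->
  exists m, [/\ cle n m, cle m c, P m & forall i, (m i < c i)%N -> ~ P (incr m i)].
Proof.
have [k] := ubnP (\sum_i (c i - n i)); elim: k n => // k IH n; rewrite ltnS => nk nc Pn.
have [[i [ni Pi]]|nd] := pselect (exists i, (n i < c i)%N /\ P (incr n i)).
  have inc : cle (incr n i) c.
    apply/forallP => j; rewrite ffunE; case: eqP => [->|_]; rewrite ?addn1 ?addn0 //.
    exact: (forallP nc).
  have [|m [im mc Pm mmax]] := IH _ _ inc Pi.
    apply: leq_trans nk; rewrite (bigD1 i) //= [X in (_ < X)%N](bigD1 i) //=.
    rewrite -addSn leq_add //; first by rewrite ffunE eqxx; lia.
    by apply: leq_sum => j ji; rewrite ffunE (negbTE ji) addn0.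
  exists m; split=> //; apply: cle_trans im; apply/forallP => j.
  by rewrite ffunE leq_addr.
exists n; split; rewrite ?cle_refl // => i ni Pi.
by apply: nd; exists i.
Qed.

End Contents.

Section HighestWeight.
Variables (R : realType) (I : finType) (A : I -> I -> R) (D : realization A).

Lemma wsum_cont w : wsum D w = lincomb D (cont w).
Proof.
rewrite /lincomb; elim: w => [|i w IH]; rewrite /wsum ?big_nil ?big_cons.
  by rewrite big1 // => i _; rewrite ffunE scale0r.
rewrite -/(wsum D w) IH cont_cons (bigD1 i) //= [in RHS](bigD1 i) //=.
rewrite incrE eqxx natrD scalerDl scale1r addrA [sroot D i + _]addrC; congr (_ + _).
by apply: eq_bigr => j /negbTE ji; rewrite incrE ji addn0.
Qed.

Lemma lincomb_inj (c d : {ffun I -> nat}) : lincomb D c = lincomb D d -> c = d.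
Proof.
move=> cd; have /freeP fr := sroot_free D.
have lE (c' : I -> nat) : lincomb D c' = \sum_(k < #|I|)
    (c' (enum_val k))%:R *: (image_tuple (sroot D) I)`_k.
  rewrite /lincomb (reindex (@enum_val I I)) /=; last exact/onW_bij/enum_val_bij.
  by apply: eq_bigr => k _; rewrite nth_image.
move: cd; rewrite !lE => /eqP; rewrite -subr_eq0 -sumrB.
under eq_bigr do rewrite -scalerBl.
move=> /eqP /fr c0; apply/ffunP => i; apply/eqP; rewrite -(eqr_nat R[i]) -subr_eq0.
by have /eqP := c0 (enum_rank i); rewrite enum_rankK.
Qed.

Lemma wsum_neq0 (mu : dual_cartan D) w : w != [::] -> mu - wsum D w <> mu.
Proof.
move=> wn /eqP; rewrite -subr_eq0 addrAC subrr sub0r oppr_eq0 => /eqP w0.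
have : lincomb D (cont w) = lincomb D (cont [::]).
  by rewrite -!wsum_cont w0 /wsum big_nil.
move/lincomb_inj/eqP; rewrite cont_perm => /perm_nilP wE.
by rewrite wE in wn.
Qed.

Lemma lincomb_coroot (c : I -> nat) i :
  lincomb D c (coroot D i) = (\sum_j (c j)%:R * A i j)%:C.
Proof.
rewrite /lincomb sum_lfunE rmorph_sum; apply: eq_bigr => j _.
by rewrite lfunE /= sroot_coroot rmorphM rmorph_nat.
Qed.

Variables (lam : dual_cartan D) (V : lieModType (bkm D)).

Local Notation e i := (act (bkm_e D i)).
Local Notation f i := (act (bkm_f D i)).
Local Notation word_span P x :=
  (lspan (fun u => exists2 w : seq I, P w & u = fword w x)).

Definition hw_vector (v0 : V) :=
  [/\ v0 != 0, forall i, e i v0 = 0, wt_space lam v0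
    & forall v, word_span (fun=> True) v0 v].

Lemma hw_vector_exists : highest_weight_module lam V -> exists v0, hw_vector v0.
Proof.
case=> [[v1 v1n0] [p [pact psurj]]].
pose g0 : verma lam := mclass (verma_rel lam) (MGen tt).
have ge i : e i (p g0) = 0.
  rewrite -pact; have -> : act (bkm_e D i) g0 = 0; last by rewrite linear0.
  rewrite -[act _ _]/(mp_act (bkm_e D i) g0) mclassA.
  by apply/mclassP/mcongr_rel/verma_e.
have gh : wt_space lam (p g0).
  move=> x; rewrite -pact.
  have -> : act (bkm_h x) g0 = lam x *: g0; last by rewrite linearZ.
  rewrite -[act _ _]/(mp_act (bkm_h x) g0) -[_ *: _]/(mp_scale (lam x) g0).
  rewrite mclassA mclassZ.
  by apply/mclassP/mcongr_rel/verma_h.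
have gs v : word_span (fun=> True) (p g0) v.
  have [m <-] := psurj v; rewrite -[m]mreprK.
  elim: (repr m) => {m v} [[]||s IHs t IHt|s IHs|a s IHs|x s IHs].
  - by apply: lspan_sub; exists [::].
  - by rewrite -[mclass _ _]/(0 : verma lam) linear0; apply: lspan0.
  - rewrite -mclassD -[mp_add _ _]/(mclass _ s + mclass _ t : verma lam) linearD.
    exact: lspanD.
  - rewrite -mclassN -[mp_opp _]/(- (mclass _ s : verma lam)) -scaleN1r linearZ.
    exact: lspanZ.
  - rewrite -mclassZ -[mp_scale _ _]/(a *: (mclass _ s : verma lam)) linearZ.
    exact: lspanZ.
  rewrite -mclassA -[mp_act _ _]/(act x (mclass _ s : verma lam)) pact.
  exact: singular_span_act gh ge x _ IHs.
exists (p g0); split=> //; apply: contra v1n0 => /eqP g00; apply/eqP.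
by apply: lspan_eq0 (gs v1) => _ [w _ ->]; rewrite g00 linear0.
Qed.

Variables (v0 : V) (v0P : hw_vector v0).

Let v0_neq0 : v0 != 0. Proof. by case: v0P. Qed.
Let e_v0 i : e i v0 = 0. Proof. by case: v0P. Qed.
Let lam_v0 : wt_space lam v0. Proof. by case: v0P. Qed.
Let span_v0 v : word_span (fun=> True) v0 v. Proof. by case: v0P. Qed.

Lemma word_span_wt P mu v : (forall w, P w -> fword w v0 != 0 -> lam - wsum D w <> mu) ->
  word_span P v0 v -> wt_space mu v -> v = 0.
Proof.
move=> Pw vP; pose Q u := exists2 w, lam - wsum D w <> mu & u = fword w v0.
apply: (@wt_space_indep _ _ _ _ _ mu Q).
  by move=> _ [w wmu ->]; exists (lam - wsum D w) => //; apply: wt_space_fword.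
apply: (@lspan_map _ _ _ idfun _ _ _ _ vP) => _ [w wP ->] /=.
have [->|w0] := eqVneq (fword w v0) 0; first exact: lspan0.
by apply: lspan_sub; exists w => //; apply: Pw.
Qed.

Lemma wtP mu : wt V mu <-> exists2 w, mu = lam - wsum D w & fword w v0 != 0.
Proof.
split=> [[v vmu vn0]|[w -> w0]]; last by exists (fword w v0) => //; apply: wt_space_fword.
apply: contrapT => nw; move/eqP: vn0; apply; apply: word_span_wt (span_v0 v) vmu.
by move=> w _ w0 wmu; apply: nw; exists w.
Qed.

Lemma wt_space_lam v : wt_space lam v -> exists a, v = a *: v0.
Proof.
move=> vl; pose P (w : seq I) := w != [::].
have [a va] : exists a, word_span P v0 (v - a *: v0).
  elim: (span_v0 v) => [|b _ y [w _ ->] _ [a IH]].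
    by exists 0; rewrite scale0r subr0; apply: lspan0.
  case: (eqVneq w [::]) => [->|wn].
    by exists (b + a); rewrite /= scalerDl [_ + y]addrC addrKA.
  by exists a; rewrite -addrA; apply: lspanS => //; exists w.
exists a; apply/eqP; rewrite -subr_eq0; apply/eqP.
apply: word_span_wt va _; last first.
  by apply: wt_spaceD => //; rewrite -scaleN1r; do 2!apply: wt_spaceZ.
by move=> w wn _; apply: wsum_neq0.
Qed.

Definition wtc (c : {ffun I -> nat}) := exists2 w, cont w = c & fword w v0 != 0.

Lemma wtcP (c : {ffun I -> nat}) : wt V (lam - lincomb D c) <-> wtc c.
Proof.
split=> [/wtP[w wc w0]|[w <- w0]]; last by apply/wtP; exists w; rewrite ?wsum_cont.
exists w => //; apply: lincomb_inj; rewrite -wsum_cont.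
by apply/oppr_inj/(addrI lam).
Qed.

Lemma blocked m i : wtc m -> ~ wtc (incr m i) -> exists k k',
  [/\ (k <= m i)%N, (k' <= m i)%N,
      lam (coroot D i) = k%:R * (A i i)%:C / 2
    & \sum_j (m j)%:R * A i j = (k + k')%:R * A i i / 2].
Proof.
move=> [w wm w0] bl.
have [k km lamk] : exists2 k, (k <= m i)%N & lam (coroot D i) = k%:R * (A i i)%:C / 2.
  pose P k := `[< exists2 t, cont (t ++ nseq k i) = m & fword (t ++ nseq k i) v0 != 0 >].
  have P0 : exists k, P k by exists 0; apply/asboolP; exists w; rewrite cats0.
  have Pb k : P k -> (k <= m i)%N.
    by move=> /asboolP[t <- _]; rewrite cont_cat cont_nseq eqxx muln1 leq_addl.
  case: (ex_maxnP P0 Pb) => k Pk kmax; exists k; first exact: Pb.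
  move/asboolP: Pk => [t tm tn0]; pose x := iter k.+1 (f i) v0.
  have xw : wt_space (lam - k.+1%:R *: sroot D i) x by apply: wt_space_iter_f.
  have tx0 : fword t x = 0.
    apply/eqP/negP => /negP tx; apply: bl; exists (t ++ nseq k.+1 i).
      apply/ffunP => j; rewrite -tm [RHS]ffunE !cont_cat !cont_nseq eq_sym.
      by case: eqP => _; rewrite ?muln1 ?muln0 ?addnS ?addn1 ?addn0.
    by rewrite fword_cat fword_nseq.
  have := e_fword i t xw; rewrite tx0 linear0 sub0r => tspan.
  have /eqP : fword t (e i x) = 0.
    apply/eqP; rewrite -oppr_eq0; apply/eqP.
    apply: lspan_eq0 tspan => _ [t' t't ->]; apply/eqP/negP => /negP tx.
    suff /kmax : P k.+1 by rewrite ltnn.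
    apply/asboolP; exists t'; last by rewrite fword_cat fword_nseq.
    apply/eqP; rewrite -tm cont_perm perm_sym.
    apply: (perm_trans (y := (i :: t') ++ nseq k i)).
      by rewrite perm_cat2r perm_sym.
    by rewrite perm_sym; apply/permPl/(perm_catCA t' [:: i] (nseq k i)).
  rewrite /x (e_iter_f k lam_v0) // linearZ scaler_eq0 mulf_eq0 pnatr_eq0 /=.
  by rewrite subr_eq0 -fword_nseq -fword_cat (negbTE tn0) orbF => /eqP.
have xw := wt_space_fword w lam_v0; set x := fword w v0 in xw.
have fx : f i x = 0.
  by apply/eqP/negP => /negP fx; apply: bl; exists (i :: w); rewrite ?cont_cons ?wm.
pose P l := iter l (e i) x != 0.
have P0 : exists l, P l by exists 0.
have Pb l : P l -> (l <= m i)%N.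
  apply: contraLR; rewrite -ltnNge /P negbK => ml; apply/eqP.
  apply: lspan_eq0 (iter_e_fword l w lam_v0 (e_v0 i)) => u [t /permP tw _].
  have := tw (pred1 i); rewrite count_cat count_nseq /= eqxx mul1n => cw.
  by move: ml; rewrite -wm ffunE -cw ltnNge leq_addr.
case: (ex_maxnP P0 Pb) => k' Pk' k'max.
exists k, k'; split=> //; first exact: Pb.
have e0 : iter k'.+1 (e i) x = 0.
  by apply/eqP/negP => /negP /k'max; rewrite ltnn.
have := f_iter_e k' xw fx; rewrite e0 linear0 => /esym/eqP.
rewrite scaler_eq0 oppr_eq0 mulf_eq0 pnatr_eq0 /= (negbTE Pk') orbF.
rewrite lfunE /= lfunE /= wsum_cont wm lincomb_coroot lamk => /eqP E.
apply: (@complexI R).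
rewrite !rmorphM fmorphV !rmorph_nat natrD /=.
set S := (\sum_j _)%:C in E *.
have -> : S = (k%:R * (A i i)%:C / 2 - S + k'%:R * (A i i)%:C / 2) * -1 +
   (k%:R + k'%:R) * (A i i)%:C / 2 by field.
by rewrite E mul0r add0r.
Qed.

End HighestWeight.

(** * Minimal holes *)

Lemma sumr_le0_eq0 (R : numDomainType) (I : finType) (P : pred I) (F : I -> R) :
  (forall i, P i -> F i <= 0) -> 0 <= \sum_(i | P i) F i ->
  forall i, P i -> F i = 0.
Proof.
move=> Fle0 s0 i Pi; apply/eqP; rewrite -oppr_eq0.
have : \sum_(i | P i) - F i == 0.
  by rewrite sumrN oppr_eq0 eq_le s0 andbT; apply: sumr_le0.
rewrite psumr_eq0 => [/allP/(_ i)|j /Fle0]; rewrite ?oppr_ge0 //.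
by rewrite mem_index_enum Pi; apply.
Qed.

Section Holes.
Variables (R : realType) (I : finType) (A : I -> I -> R).
Hypothesis hA : bkm_cartan_matrix A.
Variables (D : realization A) (lam : dual_cartan D) (V : lieModType (bkm D)).
Variables (v0 : V) (v0P : hw_vector lam v0).
Implicit Types c d m : {ffun I -> nat}.

Local Notation e i := (act (bkm_e D i)).
Local Notation wtc := (wtc v0).
Local Notation supp c := [set i | c i != 0%N]%SET.

Lemma cartan_sym0 i j : A i j = 0 -> A j i = 0.
Proof. by case: hA => _ /(_ i j)[]. Qed.

Lemma cartan_le0 i j : i != j -> A i j <= 0.
Proof. by case: hA => _ _ /(_ i j). Qed.

Lemma cartan_diag i : (i \in Ipos A) || (A i i <= 0).
Proof. by rewrite inE; case: hA => /(_ i)[-> |->]; rewrite ?eqxx ?orbT. Qed.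

Lemma cartan_real i : i \in Ipos A -> A i i = 2.
Proof. by rewrite inE => /eqP. Qed.

Lemma half_cartan_real i (k : nat) :
  i \in Ipos A -> k%:R * (A i i)%:C / 2 = k%:R :> R[i].
Proof. by move=> /cartan_real->; rewrite rmorph_nat mulfK ?pnatr_eq0. Qed.

Lemma cartan_le_opp1 i j : i \in Ipos A -> j != i -> A i j != 0 -> A i j <= -1.
Proof.
move=> /cartan_real Aii ji; case: hA => _ _ _ /(_ i j Aii ji)[n ->].
by rewrite oppr_eq0 pnatr_eq0 lerN2 ler1n lt0n.
Qed.

Lemma blocked_isolated m i : wtc m -> ~ wtc (incr m i) -> A i i <= 0 \/ m i = 0%N ->
  forall j, j != i -> m j != 0%N -> A i j = 0.
Proof.
move=> wm /(blocked v0P wm)[k [k' [km k'm _]]] + mi j ji mj.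
rewrite (bigD1 i) //= => sE.
have /(_ j ji)/eqP : forall j, j != i -> (m j)%:R * A i j = 0.
  apply: sumr_le0_eq0 => [l li|].
    by rewrite mulr_ge0_le0 // cartan_le0 // eq_sym.
  have -> : \sum_(l | l != i) (m l)%:R * A i l = - ((m i)%:R - (k + k')%:R / 2) * A i i.
    by move/(canRL (addKr _)): sE => ->; ring.
  case: mi => [Aii|mi0].
    rewrite mulr_le0 // oppr_le0 subr_ge0 ler_pdivrMr // -natrM ler_nat.
    by lia.
  move: km k'm; rewrite mi0 !leqn0 => /eqP-> /eqP->.
  by rewrite addn0 mul0r subr0 oppr0 mul0r.
by rewrite mulf_eq0 pnatr_eq0 (negbTE mj) => /eqP.
Qed.

Lemma wtc_le_indep c d : independent A (supp c) -> cle d c -> wtc c -> wtc d.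
Proof.
move=> ic /forallP dc [w wc w0]; pose b := [ffun i => c i - d i]%N.
have ww : perm_eq w (word_of b ++ word_of d).
  rewrite -cont_perm; apply/eqP/ffunP => i.
  by rewrite wc cont_cat !word_ofK ffunE subnK.
exists (word_of d); first exact: word_ofK.
move: w0; rewrite (fword_perm _ _ ww) ?fword_cat; first exact: fword_neq0.
by move=> i j iw jw; apply: ic; rewrite inE -wc -lt0n cont_gt0.
Qed.

Lemma wtc0 : wtc [ffun=> 0%N].
Proof.
exists [::]; first by apply/ffunP => i; rewrite !ffunE.
by case: v0P.
Qed.

Lemma fprod_fword (H : {set I}) m (v : V) :
  Defs.fprod H m v = fword (flatten [seq nseq (m i) i | i <- enum H]) v.
Proof.
rewrite /Defs.fprod; elim: (enum H) => //= i s ->.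
by rewrite fword_cat fword_nseq.
Qed.

Lemma cont_fprod (H : {set I}) m : (forall i, i \notin H -> m i = 0%N) ->
  cont (flatten [seq nseq (m i) i | i <- enum H]) = m.
Proof.
move=> mH; apply/ffunP => i; rewrite ffunE count_flatten -map_comp sumnE big_map.
rewrite big_enum /=; have [iH|iH] := boolP (i \in H); last first.
  rewrite mH // big1 // => j jH; rewrite count_nseq /=.
  by case: eqP iH jH => [-> /negbTE->//|].
rewrite (bigD1 i) //= count_nseq /= eqxx mul1n big1 ?addn0 // => j /andP[_ ji].
by rewrite count_nseq /= (negbTE ji).
Qed.

Section MinimalNonWeight.
Variables (c : {ffun I -> nat}) (cN : ~ wtc c).
Hypothesis cmin : forall d, cle d c -> d <> c -> wtc d.

Let decr i : {ffun I -> nat} := [ffun j => c j - (j == i)]%N.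

Let decr_wtc i : c i != 0%N -> wtc (decr i).
Proof.
move=> ci; apply: cmin; first by apply/forallP => j; rewrite ffunE leq_subr.
by move/ffunP/(_ i); rewrite ffunE eqxx; move: ci; case: (c i) => // n _; lia.
Qed.

Let decr_blocked i : c i != 0%N -> ~ wtc (incr (decr i) i).
Proof.
move=> ci; suff -> : incr (decr i) i = c by [].
apply/ffunP => j; rewrite incrE ffunE; case: eqP => [->|_]; lia.
Qed.

Lemma minimal_nonweight_hw i : c i != 0%N -> exists k k',
  [/\ (k < c i)%N, (k' < c i)%N, lam (coroot D i) = k%:R * (A i i)%:C / 2
    & \sum_j (decr i j)%:R * A i j = (k + k')%:R * A i i / 2].
Proof.
move=> ci; have [k [k' [kc kc' lk s]]] := blocked v0P (decr_wtc ci) (@decr_blocked i ci).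
exists k, k'; split=> //; [move: kc|move: kc']; rewrite ffunE eqxx; lia.
Qed.

Lemma minimal_nonweight_indep : independent A (supp c).
Proof.
move=> i j; rewrite !inE => ci cj ij.
have [//|Aij] := eqVneq (A i j) 0.
wlog cji : i j ci cj ij Aij / (c j <= c i)%N.
  case/orP: (leq_total (c i) (c j)) => cij wl; last exact: wl.
  apply/cartan_sym0/wl => //; first by rewrite eq_sym.
  by apply: contra Aij => /eqP/cartan_sym0->.
have iso k l : c k != 0%N -> c l != 0%N -> k != l -> A k k <= 0 -> A k l = 0.
  move=> ck cl kl Akk; apply: blocked_isolated (decr_wtc ck) (@decr_blocked k ck) _ _ _ _.
  - by left.
  - by rewrite eq_sym.
  - by rewrite ffunE (eq_sym l) (negbTE kl) subn0.
case/orP: (cartan_diag j) => [jp|Ajj]; last first.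
  by apply: cartan_sym0; apply: iso; rewrite // eq_sym.
have Aji : A j i <= -1.
  apply: cartan_le_opp1 => //; apply: contra Aij => /eqP/cartan_sym0->.
  exact: eqxx.
(* On a word of content c without its j-part, which e_j kills, h_j acts by at
   least c_i >= c_j, so c_j further letters f_j do not kill it. *)
pose d : {ffun I -> nat} := [ffun l => if l == j then 0%N else c l].
have [w wd w0] : wtc d.
  apply: cmin; first by apply/forallP => l; rewrite ffunE; case: eqP.
  by move/ffunP/(_ j); rewrite ffunE eqxx => cj0; rewrite -cj0 in cj.
exfalso; apply: cN; exists (nseq (c j) j ++ w).
  apply/ffunP => l; rewrite cont_cat cont_nseq wd ffunE eq_sym.
  by case: eqP => [->|_]; rewrite ?muln1 ?muln0 ?addn0.
case: (v0P) => _ ev0 lamv0 _; have yw := wt_space_fword w lamv0.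
rewrite fword_cat fword_nseq; set y := fword w v0 in w0 yw *.
have ey : e j y = 0.
  have := e_fword j w lamv0; rewrite ev0 linear0 subr0; apply: lspan_eq0 => u [t tw _].
  have : (0 < cont w j)%N by rewrite cont_gt0 -(perm_mem tw) mem_head.
  by rewrite wd ffunE eqxx.
have [k [_ [_ _ lk _]]] := minimal_nonweight_hw cj.
have [p pE cp] : exists2 p : R, (lam - wsum D w) (coroot D j) = p%:C & (c j)%:R <= p.
  exists (k%:R - \sum_l (d l)%:R * A j l).
    rewrite lfunE /= lfunE /= wsum_cont wd lincomb_coroot lk half_cartan_real //.
    by rewrite rmorphB rmorph_nat.
  rewrite (bigD1 i) //= opprD addrA -[leLHS]addr0 lerD //.
    rewrite -[leLHS]add0r lerD // ffunE (negbTE ij) -mulrN.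
    apply: le_trans (_ : (c i)%:R <= _); first by rewrite ler_nat.
    by rewrite ler_peMr // lerNr.
  rewrite -sumrN sumr_ge0 // => l _; rewrite ffunE; case: eqVneq => [|lj].
    by rewrite mul0r oppr0.
  by rewrite -mulrN mulr_ge0 // oppr_ge0 cartan_le0 // eq_sym.
have : (c j <= c j)%N by [].
elim: {1 3}(c j) => // n IH nc; apply/negP => /eqP fn0.
have := e_iter_f n yw ey; rewrite fn0 linear0 => /esym/eqP.
rewrite scaler_eq0 mulf_eq0 pnatr_eq0 /= (negbTE (IH (ltnW nc))) orbF.
rewrite pE half_cartan_real // subr_eq0.
rewrite -(rmorph_nat (real_complex R)) (inj_eq (@complexI R)) => /eqP pn.
by move: cp; rewrite pn ler_nat leqNgt nc.
Qed.

Lemma minimal_nonweight_mult i : c i != 0%N -> exists2 k,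
  lam (coroot D i) = k%:R * (A i i)%:C / 2 & A i i != 0 -> c i = k.+1.
Proof.
move=> ci; have [k [k' [kc kc' lk]]] := minimal_nonweight_hw ci.
rewrite (bigD1 i) //= big1 ?addr0 => [s|j ji]; last first.
  rewrite ffunE (negbTE ji) subn0; have [->|cj] := eqVneq (c j) 0%N.
    by rewrite mul0r.
  by rewrite minimal_nonweight_indep ?mulr0 // ?inE // eq_sym.
exists k => // Aii; move: s; rewrite mulrAC => /(mulIf Aii)/(congr1 (fun x => x * 2)).
by rewrite divfK ?pnatr_eq0 // -natrM => /eqP; rewrite eqr_nat ffunE eqxx => /eqP; lia.
Qed.

Lemma minimal_nonweight_hole : hole lam V (supp c, c).
Proof.
split; first split.
- apply/negP => /eqP/setP c0; apply: cN.
  suff -> : c = [ffun=> 0%N] by apply: wtc0.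
  by apply/ffunP => i; apply/eqP; have := c0 i; rewrite !inE ffunE => /negbFE.
- move=> i; rewrite inE => /minimal_nonweight_mult[k lk _]; exists k.
  by rewrite lk; ring.
- exact: minimal_nonweight_indep.
- split=> [i|i|i]; rewrite !inE ?negbK.
  + by move/eqP.
  + move=> ci Ai; have [k -> ck] := minimal_nonweight_mult ci.
    have Ai0 : A i i != 0 by case/orP: Ai => [/eqP->|/lt_eqF->]; rewrite ?pnatr_eq0.
    rewrite ck // -natr1; congr (_ + 1).
    by field; rewrite (inj_eq (@complexI R) _ 0).
  + by move=> ci _; rewrite lt0n.
move=> v /(wt_space_lam v0P)[a ->].
rewrite fprod_fword linearZ /=; apply/eqP; rewrite scaler_eq0; apply/orP; right.
apply/negP => /negP fv; apply: cN.
exists (flatten [seq nseq (c i) i | i <- enum (supp c)]) => //.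
by apply: cont_fprod => i; rewrite inE negbK => /eqP.
Qed.

Lemma hole_gt0 H m i : hole lam V (H, m) -> i \in H -> m i != 0%N.
Proof.
case=> [[_ HJ _] [_ m1 m2] _] iH.
have [i0|i0] := eqVneq (A i i) 0.
  by rewrite -lt0n; apply: m2; rewrite ?inE ?i0.
have [n ln] := HJ i iH; have : (m i)%:R = n%:R + 1 :> R[i].
  rewrite m1 //; last first.
    rewrite !inE; case/orP: (cartan_diag i) => [|Aii]; first by rewrite inE => ->.
    by rewrite lt_neqAle i0 Aii orbT.
  by rewrite ln; field; rewrite (inj_eq (@complexI R) _ 0).
by rewrite natr1 => /eqP; rewrite eqr_nat => /eqP->.
Qed.

Lemma minimal_nonweight_minimal_hole : minimal_hole lam V (supp c, c).
Proof.
split; first exact: minimal_nonweight_hole.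
move=> [[H m] [/= mh mN Hc mc]]; have [[_ _ _] [m0 _ _] mv] := mh.
have lmc : cle m c.
  apply/forallP => i; have [/mc//|/m0->] := boolP (i \in H).
  exact: leq0n.
have mNc : m <> c.
  move=> mE; apply: mN; rewrite mE; congr (_, _); apply/setP => i; rewrite inE -mE.
  by apply/idP/idP => [/(hole_gt0 mh)//|]; apply: contraR => /m0->.
have [w wm] := cmin lmc mNc; case: (v0P) => _ _ lamv0 _.
rewrite (@fword_perm _ _ _ _ _ w (flatten [seq nseq (m i) i | i <- enum H])).
- by rewrite -fprod_fword mv ?eqxx.
- move=> i j iw jw; apply: minimal_nonweight_indep; rewrite inE -lt0n.
    by apply: leq_trans (forallP lmc i); rewrite -wm cont_gt0.
  by apply: leq_trans (forallP lmc j); rewrite -wm cont_gt0.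
by rewrite -cont_perm cont_fprod // wm.
Qed.

End MinimalNonWeight.

Lemma nice_nonweight c : nice lam V -> ~ wtc c -> exists d,
  [/\ cle d c, ~ wtc d & forall i, d i != 0%N -> A i i <= 0 \/ I_V lam V i].
Proof.
move=> nV cN; have [d [dc dN dmin]] := @exists_minimal _ (fun c => ~ wtc c) _ cN.
exists d; split=> // i di.
have {}dmin d' : cle d' d -> d' <> d -> wtc d'.
  by move=> d'd d'N; apply: contrapT; apply: dmin.
case: (nV _ (minimal_nonweight_minimal_hole dN dmin)) => /= [/fintype.subsetP/(_ i)|[]].
  by rewrite !inE => /(_ di)/orP[/ltW|/eqP->]; left.
move=> /fintype.subsetP/(_ i); rewrite inE => /(_ di) ip /eqP/cards1P[j dj]; right.
have [k lk dk] := minimal_nonweight_mult dN dmin di.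
split=> //; exists k; first by rewrite lk half_cartan_real.
move=> v /(wt_space_lam v0P)[a ->].
rewrite -fword_nseq linearZ /=; apply/eqP; rewrite scaler_eq0; apply/orP; right.
apply/negP => /negP fv; apply: dN; exists (nseq k.+1 i) => //.
apply/ffunP => l; rewrite cont_nseq -dk ?(cartan_real ip) ?pnatr_eq0 //.
have ij : i = j by apply/eqP; rewrite -in_set1 -dj inE.
case: eqVneq => [<-|il]; rewrite ?muln1 ?muln0 //.
apply/esym; apply: contraNeq il => dl.
by rewrite ij eq_sym -in_set1 -dj inE.
Qed.

End Holes.

(** * Filling up a content *)

Section Superset.
Variables (R : realType) (I : finType) (A : I -> I -> R).
Hypothesis hA : bkm_cartan_matrix A.
Variables (D : realization A) (lam : dual_cartan D) (V : lieModType (bkm D)).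
Variables (v0 : V) (v0P : hw_vector lam v0).
Implicit Types c d m : {ffun I -> nat}.

Local Notation wtc := (wtc v0).
Local Notation supp c := [set i | c i != 0%N]%SET.
Local Notation edge c := (dynkin_in A (supp c)).

Lemma dynkin_in_sym (J : {set I}) : connect_sym (dynkin_in A J).
Proof.
have sub i j : dynkin_in A J i j -> dynkin_in A J j i.
  move=> /and4P[iJ jJ ij Aij]; apply/and4P; split; rewrite // 1?(eq_sym j) //.
  by apply: contra Aij => /eqP/(cartan_sym0 hA)->.
by apply: sym_connect_sym => i j; apply/idP/idP; apply: sub.
Qed.

Lemma connect_ind (T : finType) (g : rel T) (P : T -> Prop) x y :
  connect g x y -> P x -> (forall a b, g a b -> P a -> P b) -> P y.
Proof.
move=> /connectP[p gp ->] Px gP; elim: p x gp Px => //= b p IH x /andP[gxb gp] Px.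
exact: IH gp (gP _ _ gxb Px).
Qed.

Section Extend.
Variables c s : {ffun I -> nat}.
Hypothesis lam_nice : nice lam V.
Hypotheses (sc : cle s c) (ws : wtc s) (sI : independent A (supp s)).
Hypothesis s_reach : forall i, c i != 0%N ->
  exists2 j, s j != 0%N & connect (edge c) j i.
Hypothesis s_full : forall i, c i != 0%N ->
  (exists j, [/\ j != i, c j != 0%N & A i j != 0]) \/ s i = c i.
Hypothesis c_dom : condC1 lam V (lam - lincomb D c).

Let free i := (i \in Ipos A) && ~~ `[< I_V lam V i >].
Let n : {ffun I -> nat} := [ffun i => if free i then c i else s i].

Let wtc_n : wtc n.
Proof.
apply: contrapT => /(nice_nonweight hA v0P lam_nice)[d [/forallP dn dN dS]]; apply: dN.
apply: (wtc_le_indep sI) ws; apply/forallP => i.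
have [->|di] := eqVneq (d i) 0%N; first exact: leq0n.
have := dn i; rewrite ffunE ifF //; apply/negP => /andP[ip /asboolP iV].
by case: (dS i di) => //; rewrite (cartan_real ip) lern0.
Qed.

Let s_le_n : cle s n.
Proof. by apply/forallP => i; rewrite ffunE; case: ifP => // _; apply: (forallP sc). Qed.

Let n_le_c : cle n c.
Proof. by apply/forallP => i; rewrite ffunE; case: ifP => // _; apply: (forallP sc). Qed.

Section Maximal.
Variable m : {ffun I -> nat}.
Hypotheses (nm : cle n m) (mc : cle m c) (wm : wtc m).
Hypothesis m_max : forall i, (m i < c i)%N -> ~ wtc (incr m i).

Let s_m i : s i != 0%N -> m i != 0%N.
Proof.
rewrite -!lt0n => /leq_trans; apply.
exact: leq_trans (forallP s_le_n i) (forallP nm i).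
Qed.

Let m_full i : c i != 0%N -> m i != 0%N.
Proof.
move=> /s_reach[j sj ji].
apply: (@connect_ind _ _ (fun l => m l != 0%N) _ _ ji (s_m sj)).
move=> a b /= /and4P[]; rewrite !inE => ca cb ab Aab ma.
apply/eqP => mb; move/eqP: Aab; apply; apply: (cartan_sym0 hA).
have mcb : (m b < c b)%N by rewrite mb lt0n.
by apply: (blocked_isolated hA v0P wm (m_max mcb)) => //; right.
Qed.

Let deficient_I_V i : (m i < c i)%N -> I_V lam V i.
Proof.
move=> mci; have ci : c i != 0%N by rewrite -lt0n; apply: leq_ltn_trans mci.
case: (s_full ci) => [[j [ji cj Aij]]|sci]; last first.
  move: mci; rewrite -sci ltnNge (leq_trans (forallP s_le_n i)) //.
  exact: (forallP nm).
case/orP: (cartan_diag hA i) => [ip|Aii]; last first.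
  move/eqP: Aij; case; apply: (blocked_isolated hA v0P wm (m_max mci)) => //.
    by left.
  exact: m_full.
apply: contrapT => iV; have := forallP nm i.
rewrite ffunE ifT; first by rewrite leqNgt mci.
by rewrite /free ip /=; apply/asboolPn.
Qed.

Let extremal i := (m i < c i)%N /\
  forall j, (m i * (c j - m j) <= (c i - m i) * m j)%N.

Let extremal_exists i1 : (m i1 < c i1)%N -> exists i, extremal i.
Proof.
move=> mci1; pose q i : R := (c i - m i)%:R / (m i)%:R.
have [i mci imax] := @Order.TotalTheory.arg_maxP _ R I i1
  (fun i => (m i < c i)%N) q mci1.
have mpos j : (m j < c j)%N -> 0 < (m j)%:R :> R.
  move=> mcj; rewrite ltr0n lt0n m_full // -lt0n; exact: leq_ltn_trans mcj.
exists i; split=> // j; case: (leqP (c j) (m j)) => [|mcj].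
  by rewrite -subn_eq0 => /eqP->; rewrite muln0.
have := imax j mcj; rewrite /q /= ler_pdivrMr ?mpos // mulrAC ler_pdivlMr ?mpos //.
by rewrite -!natrM ler_nat mulnC.
Qed.

Let extremal_spread i : extremal i ->
  lam (coroot D i) = 0 /\ forall j, edge c i j -> extremal j.
Proof.
move=> [mci iext]; have iV := deficient_I_V mci; have [ip _] := iV.
have mi : m i != 0%N by rewrite m_full // -lt0n; apply: leq_ltn_trans mci.
have [k [k' [_ _ lk sm]]] := blocked v0P wm (m_max mci).
rewrite half_cartan_real // in lk; rewrite (cartan_real ip) mulfK ?pnatr_eq0 // in sm.
have sc_le : \sum_j (c j)%:R * A i j <= k%:R.
  have [p] := c_dom iV; rewrite lfunE /= lfunE /= lincomb_coroot lk.
  move=> E; have -> : \sum_j (c j)%:R * A i j = k%:R - p%:R.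
    by apply: (@complexI R); rewrite rmorphB !rmorph_nat /= -E opprB addrC subrK.
  by rewrite gerBl ler0n.
pose F j := ((m i * (c j - m j))%:R - ((c i - m i) * m j)%:R) * A i j : R.
have F_ge0 j : 0 <= F j.
  rewrite /F; have [->|ij] := eqVneq i j; first by rewrite mulnC subrr mul0r.
  by rewrite mulr_le0 ?(cartan_le0 hA) // subr_le0 ler_nat.
have sF : \sum_j F j <= - (c i - m i)%:R * (k + k')%:R.
  have -> : \sum_j F j = (m i)%:R * (\sum_j (c j)%:R * A i j - \sum_j (m j)%:R * A i j)
     - (c i - m i)%:R * \sum_j (m j)%:R * A i j.
    rewrite -sumrB !mulr_sumr -sumrB; apply: eq_bigr => j _.
    by rewrite /F !natrM (natrB _ (forallP mc j)); ring.
  rewrite sm mulNr gerDr mulr_ge0_le0 ?ler0n // subr_le0.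
  by apply: le_trans sc_le _; rewrite ler_nat leq_addr.
have [k0 F0] : k = 0%N /\ \sum_j F j = 0.
  have sF0 : 0 <= \sum_j F j by apply: sumr_ge0.
  have : 0 <= - (c i - m i)%:R * (k + k')%:R :> R by apply: le_trans sF.
  rewrite mulNr oppr_ge0 -natrM lern0 muln_eq0 subn_eq0 leqNgt mci /= addn_eq0.
  move=> /andP[/eqP kE /eqP k'E]; split=> //; apply/eqP; rewrite eq_le sF0 andbT.
  by apply: le_trans sF _; rewrite kE k'E mulr0.
split=> [|j /= /and4P[_]]; first by rewrite lk k0.
rewrite inE => cj ij Aij.
have /eqP : F j = 0.
  apply/eqP; move/eqP: F0; rewrite psumr_eq0 // => /allP; apply.
  exact: mem_index_enum.
rewrite mulf_eq0 (negbTE Aij) orbF subr_eq0 eqr_nat => /eqP E.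
have mj : m j != 0%N by apply: m_full.
have mcj : (m j < c j)%N.
  rewrite -subn_gt0 lt0n; apply: contraTneq isT => cmj; move/esym/eqP: E.
  by rewrite cmj muln0 muln_eq0 (negbTE mj) subn_eq0 leqNgt mci.
split=> // l; rewrite -(leq_pmul2l (_ : 0 < m i)%N) ?lt0n //.
rewrite [leqRHS]mulnA E -[leqRHS]mulnA [leqRHS]mulnCA [leqLHS]mulnCA.
by rewrite leq_mul2l (negbTE mj) /= iext.
Qed.

Lemma maximal_below_full : m = c.
Proof.
apply/ffunP => i; apply/eqP; rewrite eqn_leq (forallP mc) leqNgt; apply/negP => mci.
have {i mci}[i iext] := extremal_exists mci.
have ci : c i != 0%N by rewrite -lt0n; case: iext => mci _; apply: leq_ltn_trans mci.
have [j sj ji] := s_reach ci; rewrite dynkin_in_sym in ji.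
have jext : extremal j.
  by apply: (@connect_ind _ _ extremal _ _ ji iext) => a b ab /extremal_spread[_]; apply.
have [lj0 _] := extremal_spread jext; have [mcj _] := jext.
have [_ [k lk]] := deficient_I_V mcj.
have -> : k = 0%N by apply/eqP; rewrite -(eqr_nat R[i]) -lk lj0.
case: (v0P) => _ _ lamv0 _ /(_ v0 lamv0) /= fv0.
pose d : {ffun I -> nat} := [ffun i => (i == j : nat)].
have [w wd] : wtc d.
  apply: (wtc_le_indep sI) ws; apply/forallP => l; rewrite ffunE.
  by case: eqP => [->|//]; rewrite lt0n.
have -> : w = [:: j].
  apply: perm_small_eq => //; rewrite -cont_perm wd; apply/eqP/ffunP => l.
  by rewrite !ffunE /= addn0 eq_sym.
by rewrite /= fv0 eqxx.
Qed.

End Maximal.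

Lemma wtc_extend : wtc c.
Proof.
have [m [nm mc wm mmax]] := exists_maximal n_le_c wtc_n.
by rewrite -(maximal_below_full nm mc wm mmax).
Qed.

End Extend.
End Superset.

(** * Condition (C2) and components *)

Section Components.
Variables (R : realType) (I : finType) (A : I -> I -> R).
Hypothesis hA : bkm_cartan_matrix A.
Variable J : {set I}.
Implicit Types C : {set I}.

Local Notation P := (components A J).

Lemma dynkin_equivalence :
  {in J & &, equivalence_rel (connect (dynkin_in A J))}.
Proof.
move=> i j k _ _ _; split=> [|ij]; first exact: connect0.
by apply/idP/idP; apply: connect_trans => //; rewrite dynkin_in_sym.
Qed.

Lemma components_partition : partition P J.
Proof. exact/equivalence_partitionP/dynkin_equivalence. Qed.

Lemma components_trivIset : trivIset P.
Proof. by case/and3P: components_partition. Qed.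

Lemma components_sub C i : C \in P -> i \in C -> i \in J.
Proof.
move=> CP iC; rewrite -(cover_partition components_partition).
by apply/bigcupP; exists C.
Qed.

Lemma pblock_component i : i \in J -> pblock P i \in P.
Proof. by move=> iJ; rewrite pblock_mem // (cover_partition components_partition). Qed.

Lemma mem_pblock_component i : i \in J -> i \in pblock P i.
Proof. by move=> iJ; rewrite mem_pblock (cover_partition components_partition). Qed.

Lemma component_connect C i j : C \in P -> i \in C -> j \in C ->
  connect (dynkin_in A J) i j.
Proof.
move=> CP iC jC; rewrite -(pblock_equivalence_partition dynkin_equivalence).
- by rewrite (def_pblock components_trivIset CP iC).
- exact: components_sub CP iC.
- exact: components_sub CP jC.
Qed.

Lemma component_edge i j : i \in J -> j \in J -> i != j -> A i j != 0 ->
  pblock P i = pblock P j.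
Proof.
move=> iJ jJ ij Aij; apply/eqP; rewrite eq_pblock ?components_trivIset //; last first.
  by rewrite (cover_partition components_partition).
rewrite (pblock_equivalence_partition dynkin_equivalence) //.
by apply/connect1/and4P.
Qed.

Lemma component_neighbour C i : C \in P -> i \in C -> #|C| != 1%N ->
  exists j, [/\ j != i, j \in J & A i j != 0].
Proof.
move=> CP iC C1; have [j jC ji] : exists2 j, j \in C & j != i.
  apply: contrapT => nj; move/eqP: C1; apply; apply/eqP/cards1P; exists i.
  apply/setP => j; rewrite inE; apply/idP/eqP => [jC|->//].
  by apply/eqP/negPn/negP => ji; apply: nj; exists j.
have /connectP[[|k p] /=] := component_connect CP iC jC.
  by move=> _ jE; rewrite jE eqxx in ji.
move=> /andP[/and4P[_ kJ ik Aik] _] _; exists k; split=> //.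
by rewrite eq_sym.
Qed.

(* The multiplicity of alpha_(jk C) in the weight mu' of condition (C2). *)
Definition comp_mult (c : I -> nat) (jk : {set I} -> I) C : nat :=
  if #|C| == 1%N then c (jk C) else 1%N.

Lemma component_sum (D : realization A) c jk :
  \sum_(C in P | #|C| == 1%N) (c (jk C))%:R *: sroot D (jk C) +
  \sum_(C in P | (1 < #|C|)%N) sroot D (jk C) =
  \sum_(C in P) (comp_mult c jk C)%:R *: sroot D (jk C).
Proof.
rewrite [RHS](bigID (fun C => #|C| == 1%N)) /=; congr (_ + _).
  by apply: eq_bigr => C /andP[_ C1]; rewrite /comp_mult C1.
apply: eq_big => [C|C /andP[_ C1]]; last by rewrite /comp_mult gtn_eqF // scale1r.
have [CP|//] := boolP (C \in P); have [_ _ P0] := and3P components_partition.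
have C0 : C != set0 by apply: contraNneq P0 => <-.
by rewrite ltn_neqAle card_gt0 C0 andbT eq_sym.
Qed.

End Components.

Section CharacterizeC2.
Variables (R : realType) (I : finType) (A : I -> I -> R).
Hypothesis hA : bkm_cartan_matrix A.
Variables (D : realization A) (lam : dual_cartan D) (V : lieModType (bkm D)).
Variables (v0 : V) (v0P : hw_vector lam v0).

Lemma condC2_wt mu : nice lam V -> condC1 lam V mu -> condC2 lam V mu -> wt V mu.
Proof.
move=> lam_nice C1; have [->|mulam] := pselect (mu = lam).
  move=> _; apply/(wtP v0P); exists [::]; first by rewrite /wsum big_nil subr0.
  by case: v0P.
case/(_ mulam) => c0 [muE].
have [c cE] : exists c : {ffun I -> nat}, c0 = c.
  by exists (finfun c0); apply/funext => i; rewrite ffunE.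
subst c0; set J := [set j | c j != 0%N]%SET => -[jk [jkC]].
rewrite -addrA -opprD component_sum //; set P := components A J in jkC *.
pose s : {ffun I -> nat} :=
  [ffun i => if (i \in J) && (jk (pblock P i) == i)
             then comp_mult c jk (pblock P i) else 0%N].
have PJ := components_partition hA J.
have pbC C i : C \in P -> i \in C -> pblock P i = C.
  exact/def_pblock/components_trivIset.
have sE C i : C \in P -> i \in C -> s i = if jk C == i then comp_mult c jk C else 0%N.
  by move=> CP iC; rewrite ffunE (pbC C) // (components_sub hA CP iC).
have -> : \sum_(C in P) (comp_mult c jk C)%:R *: sroot D (jk C) = lincomb D s.
  rewrite /lincomb (bigID (mem J)) /= [X in _ + X]big1 ?addr0; last first.
    by move=> i /negbTE iJ; rewrite ffunE iJ scale0r.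
  rewrite (set_partition_big _ PJ) /=; apply: eq_bigr => C CP.
  rewrite (bigD1 (jk C)) ?jkC //= big1 ?addr0 => [|i /andP[iC ijk]].
    by rewrite (sE C) ?jkC // eqxx.
  by rewrite (sE C) // eq_sym (negbTE ijk) scale0r.
move=> /(wtcP v0P) ws.
have c_gt0 i : i \in J -> (0 < c i)%N by rewrite inE lt0n.
rewrite muE; apply/(wtcP v0P); apply: (wtc_extend hA v0P lam_nice (s := s)) => //.
- apply/forallP => i; rewrite ffunE /comp_mult; case: ifP => [/andP[iJ /eqP jki]|//].
  by case: ifP => _; rewrite ?jki ?c_gt0.
- move=> i j; rewrite !inE !ffunE => si sj ij; apply/eqP; apply: contraNT ij => Aij.
  move: si sj; case: ifP => [/andP[iJ /eqP jki] _|//].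
  case: ifP => [/andP[jJ /eqP jkj] _|//].
  have [//|ij] := eqVneq i j; case/negP: (ij); apply/eqP.
  by rewrite -[LHS]jki -[RHS]jkj (component_edge hA iJ jJ ij Aij).
- move=> i ci; have iJ : i \in J by rewrite inE.
  have CP := pblock_component hA iJ; have jkP := jkC _ CP.
  exists (jk (pblock P i)); last first.
    exact: component_connect CP jkP (mem_pblock_component hA iJ).
  rewrite (sE _ _ CP jkP) eqxx /comp_mult; case: ifP => // _.
  by have := components_sub hA CP jkP; rewrite inE.
- move=> i ci; have iJ : i \in J by rewrite inE.
  have CP := pblock_component hA iJ; have iC := mem_pblock_component hA iJ.
  have [C1'|C1'] := eqVneq #|pblock P i| 1%N; last first.
    left; have [j [ji jJ Aij]] := component_neighbour hA CP iC C1'.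
    by exists j; split=> //; rewrite inE in jJ.
  right; rewrite (sE _ _ CP iC).
  have -> : jk (pblock P i) = i.
    have /eqP/cards1P[x xE] := C1'; have := jkC _ CP; move: iC.
    by rewrite xE !inE => /eqP-> /eqP.
  rewrite eqxx /comp_mult C1' eqxx.
  have /eqP/cards1P[x xE] := C1'; have := jkC _ CP; move: iC.
  by rewrite xE !inE => /eqP<- /eqP->.
by rewrite -muE.
Qed.

Lemma nonzero_word_condC2 w : w != [::] -> fword w v0 != 0 -> exists jk : {set I} -> I,
  let J := [set j | cont w j != 0%N]%SET in
  (forall C, C \in components A J -> jk C \in C) /\
  wt V (lam - \sum_(C in components A J) (comp_mult (cont w) jk C)%:R *: sroot D (jk C)).
Proof.
case: w => // i0 w0 _; move: (i0 :: w0) => {w0} w wv.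
set J := [set j | cont w j != 0%N]%SET; set P := components A J.
have wJ i : (i \in w) = (i \in J) by rewrite inE -lt0n cont_gt0.
have PJ := components_partition hA J.
have pbC C i : C \in P -> i \in C -> pblock P i = C.
  exact/def_pblock/components_trivIset.
pose wC (C : {set I}) := [seq i <- w | i \in C].
pose jk C := last i0 (wC C).
have jkC C : C \in P -> jk C \in C.
  move=> CP; have /set0Pn[i iC] : C != finset.set0.
    by case/and3P: PJ => _ _; apply: contraNneq => <-.
  have : i \in wC C by rewrite mem_filter iC wJ (components_sub hA CP iC).
  have : all (mem C) (wC C) by apply: filter_all.
  rewrite /jk; case: (wC C) => // x t /allP Ct _.
  by apply: Ct; rewrite /= mem_last.
have wC_suffix C : C \in P ->
    exists t, wC C = t ++ nseq (comp_mult (cont w) jk C) (jk C).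
  move=> CP; rewrite /comp_mult; case: ifP => [/cards1P[x Cx]|_].
    exists [::]; have -> : jk C = x by apply/eqP; have := jkC _ CP; rewrite {2}Cx inE.
    rewrite ffunE -[LHS](_ : nseq (size (wC C)) x = _).
      rewrite size_filter; congr nseq; apply: eq_count => y /=.
      by rewrite Cx inE.
    apply/esym/all_pred1P/allP => y; rewrite mem_filter Cx inE /=.
    by case/andP.
  have : jk C \in C by apply: jkC.
  have : wC C != [::].
    apply: contraTneq (jkC _ CP) => wC0.
    have [i iC] : exists i, i \in C by exists (jk C); apply: jkC.
    have : i \in wC C by rewrite mem_filter iC wJ (components_sub hA CP iC).
    by rewrite wC0.
  rewrite /jk; case: (lastP (wC C)) => // t x _ _.
  by exists t; rewrite last_rcons cats1.
exists jk; split=> //.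
have pull (Cs : seq {set I}) (w' : seq I) (y : V) : uniq Cs -> {subset Cs <= P} ->
    (forall i, i \in w' -> i \in J) ->
    (forall C, C \in Cs -> [seq i <- w' | i \in C] = wC C) -> fword w' y != 0 ->
    exists2 u, perm_eq u (flatten [seq nseq (comp_mult (cont w) jk C) (jk C) | C <- Cs])
             & fword u y != 0.
  elim: Cs w' y => [|C Cs IH] w' y /=.
    by move=> _ _ _ _ /fword_neq0 y0; exists [::].
  move=> /andP[CCs uCs] CsP w'J w'C.
  have CP : C \in P by apply: CsP; rewrite mem_head.
  have far i j : i \in w' -> j \in C -> i \notin C -> A i j = 0.
    move=> iw jC iC; apply/eqP/negPn/negP => Aij; case/negP: (iC).
    have jJ := components_sub hA CP jC.
    rewrite -(pbC _ _ CP jC) -(component_edge hA (w'J _ iw) jJ _ Aij).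
      exact/mem_pblock_component/w'J.
    by apply: contraNneq iC => ->.
  rewrite (fword_filter (a := mem C)); last by move=> i j iw _ iC jC; apply: far.
  rewrite [filter _ _](w'C _ (mem_head _ _)); have [t ->] := wC_suffix _ CP.
  set u := nseq _ _; rewrite -catA fword_cat => /fword_neq0.
  rewrite -fword_comm => [|i j]; last first.
    rewrite mem_filter => /andP[iC iw]; rewrite mem_nseq => /andP[_ /eqP->].
    by apply: far; rewrite ?jkC.
  rewrite fword_cat => /IH[].
  - by [].
  - by move=> C' C'Cs; apply: CsP; rewrite inE C'Cs orbT.
  - by move=> i; rewrite mem_filter => /andP[_ /w'J].
  - move=> C' C'Cs; rewrite -filter_predI -(w'C C'); last by rewrite inE C'Cs orbT.
    apply: eq_in_filter => i iw /=; case: (boolP (i \in C')) => //= iC'.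
    have C'P : C' \in P by apply: CsP; rewrite inE C'Cs orbT.
    apply/negP => iC; case/negP: CCs.
    by rewrite -(pbC _ _ CP iC) (pbC _ _ C'P iC').
  move=> u' u'p u'0; exists (u' ++ u); last by rewrite fword_cat.
  by rewrite perm_catC perm_cat2l.
have [||||u up u0] := pull (enum P) w v0 _ _ _ _ wv.
- exact: enum_uniq.
- by move=> C; rewrite mem_enum.
- by move=> i; rewrite wJ.
- by [].
apply/(wtP v0P); exists u => //; congr (_ - _).
rewrite /wsum (perm_big _ up) /= big_flatten /= big_map big_enum /=.
apply: eq_bigr => C _; rewrite big_nseq -Monoid.iteropE.
by rewrite -[RHS]/(iterop _ _ _ _) scaler_nat.
Qed.

Lemma wt_condC2 mu : wt V mu -> condC2 lam V mu.
Proof.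
move=> /(wtP v0P)[w muE w0] mulam; exists (cont w); rewrite -wsum_cont; split=> //.
have [|jk [jkC wjk]] := nonzero_word_condC2 _ w0.
  by apply: contra_notN mulam => /eqP wE; rewrite muE wE /wsum big_nil subr0.
by exists jk; split=> //; rewrite -addrA -opprD component_sum.
Qed.

End CharacterizeC2.

(** * Weyl group invariance and simple modules *)

Lemma iter_last_nonzero (V : zmodType) (g : V -> V) N x : x != 0 ->
  iter N g x = 0 -> exists t, iter t g x != 0 /\ g (iter t g x) = 0.
Proof.
move=> x0; elim: N => [/= xE|N IH]; first by rewrite xE eqxx in x0.
have [/IH//|gN] := eqVneq (iter N g x) 0.
by exists N.
Qed.

Section Weyl.
Variables (R : realType) (I : finType) (A : I -> I -> R).
Hypothesis hA : bkm_cartan_matrix A.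
Variables (D : realization A) (lam : dual_cartan D) (V : lieModType (bkm D)).
Variables (v0 : V) (v0P : hw_vector lam v0).

Local Notation e i := (act (bkm_e D i)).
Local Notation f i := (act (bkm_f D i)).

Lemma act_nilpotent (X Y : bkm D) n M (v : V) : iter n (lie X) Y = 0 ->
  iter M (act X) v = 0 -> iter (n + M) (act X) (act Y v) = 0.
Proof.
have iter0 l : iter l (act X) (0 : V) = 0 by elim: l => //= l ->; rewrite linear0.
have [k] := ubnP (n + M); elim: k n M Y v => // k IH [|n] M Y v nMk.
  by move=> /= -> _; rewrite act0l iter0.
case: M nMk => [|M] nMk; first by move=> _ /= ->; rewrite linear0 -iterS iter0.
move=> Y0 v0'; rewrite addSn iterSr act_swap.
have iterD l (x y : V) : iter l (act X) (x + y) = iter l (act X) x + iter l (act X) y.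
  by elim: l => //= l ->; rewrite linearD.
have E1 : iter (n.+1 + M) (act X) (act Y (act X v)) = 0.
  by apply: IH; rewrite -?iterSr //; lia.
have E2 : iter (n + M.+1) (act X) (act (lie X Y) v) = 0.
  by apply: IH; rewrite -?iterSr //; lia.
by rewrite iterD E2 addr0 -addSnnS.
Qed.

Lemma I_V_f_nilpotent i w : I_V lam V i -> exists N, iter N (f i) (fword w v0) = 0.
Proof.
case: (v0P) => _ _ lamv0 _ [ip [n _ fv]].
elim: w => [|j w [M fM]]; first by exists n.+1; apply: fv.
have [N adN] : exists N, iter N (lie (bkm_f D i)) (bkm_f D j) = 0.
  have [->|ji] := eqVneq j i; first by exists 1%N; apply: liexx.
  case: (hA) => _ _ _ /(_ i j (cartan_real ip) ji)[k Aij].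
  by exists k.+1; apply: lie_serre_f.
by exists (N + M)%N; apply: act_nilpotent.
Qed.

Lemma wt_coroot_int mu i : I_V lam V i -> wt V mu ->
  exists z : int, mu (coroot D i) = z%:~R.
Proof.
move=> [ip [n ln _]] /(wtP v0P)[w -> _].
have /intrP[z zE] : \sum_j (cont w j)%:R * A i j \is a Num.int.
  apply: rpred_sum => j _; apply: rpredM; first exact: natr_int.
  have [->|ji] := eqVneq j i; first by rewrite (cartan_real ip) natr_int.
  case: (hA) => _ _ _ /(_ i j (cartan_real ip) ji)[k ->].
  by rewrite rpredN natr_int.
exists (n%:Z - z); rewrite lfunE /= lfunE /= wsum_cont lincomb_coroot ln zE.
by rewrite rmorphB rmorph_int.
Qed.

Lemma wt_srefl i mu : I_V lam V i -> wt V mu -> wt V (srefl i mu).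
Proof.
move=> iV wmu; have [z muz] := wt_coroot_int iV wmu.
have [ip _] := iV; case: (v0P) => _ ev0 lamv0 _.
move/(wtP v0P): wmu => [w muE w0]; have xw := wt_space_fword w lamv0.
rewrite -muE in xw; set x := fword w v0 in w0 xw.
have real2 : (A i i)%:C / 2 = 1 :> R[i] by have := half_cartan_real 1 ip; rewrite mul1r.
case: z muz => n muz.
  have e0 : iter (cont w i).+1 (e i) x = 0.
    apply: lspan_eq0 (iter_e_fword (cont w i).+1 w lamv0 (ev0 i)) => u [t /permP tw _].
    have := tw (pred1 i); rewrite count_cat count_nseq /= eqxx mul1n.
    have -> : count_mem i w = cont w i by rewrite ffunE.
    by move: (cont w i) (count_mem i t) => a b; lia.
  have [t [y0 ey]] := iter_last_nonzero w0 e0.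
  have yw := wt_space_iter_e i t xw; set y := iter t _ x in y0 ey yw.
  have yh : (mu + t%:R *: sroot D i) (coroot D i) = (n + t.*2)%:R.
    rewrite lfunE /= lfunE /= sroot_coroot (cartan_real ip) rmorph_nat muz.
    by rewrite -pmulrn natrD -muln2 natrM.
  have fy l : (l <= n + t.*2)%N -> iter l (f i) y != 0.
    elim: l => // l IH ln; apply/negP => /eqP fl.
    have := e_iter_f l yw ey; rewrite fl linear0 => /esym/eqP.
    rewrite scaler_eq0 (negbTE (IH (ltnW ln))) orbF mulf_eq0 pnatr_eq0 /=.
    by rewrite yh half_cartan_real // subr_eq0 eqr_nat gtn_eqF.
  exists (iter (n + t) (f i) y); last by apply: fy; lia.
  have -> : srefl i mu = mu + t%:R *: sroot D i - (n + t)%:R *: sroot D i.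
    by rewrite /srefl muz -pmulrn natrD scalerDl opprD addrACA subrr addr0.
  exact: wt_space_iter_f.
have [N fN] := I_V_f_nilpotent w iV.
have [t [y0 fy]] := iter_last_nonzero w0 fN.
have yw := wt_space_iter_f i t xw; set y := iter t _ x in y0 fy yw.
rewrite NegzE mulrNz -pmulrn in muz.
have yh : (mu - t%:R *: sroot D i) (coroot D i) = - (n.+1 + t.*2)%:R.
  rewrite lfunE /= lfunE /= lfunE /= sroot_coroot (cartan_real ip) rmorph_nat muz.
  by rewrite natrD -muln2 natrM opprD.
have ey l : (l <= n.+1 + t.*2)%N -> iter l (e i) y != 0.
  elim: l => // l IH ln; apply/negP => /eqP el.
  have := f_iter_e l yw fy; rewrite el linear0 => /esym/eqP.
  rewrite scaler_eq0 (negbTE (IH (ltnW ln))) orbF oppr_eq0 mulf_eq0 pnatr_eq0 /=.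
  by rewrite yh half_cartan_real // addrC subr_eq0 eqr_nat ltn_eqF.
exists (iter (n.+1 + t) (e i) y); last by apply: ey; lia.
have -> : srefl i mu = mu - t%:R *: sroot D i + (n.+1 + t)%:R *: sroot D i.
  by rewrite /srefl muz scaleNr opprK addnC natrD scalerDl addrA subrK.
exact: wt_space_iter_e.
Qed.

Lemma wt_weyl g mu : weyl (I_V lam V) g -> wt V mu -> wt V (g mu).
Proof. by elim=> // i g' iV _ IH /IH; apply: wt_srefl. Qed.

Lemma sreflK i mu : A i i = 2 -> srefl i (srefl i mu) = mu :> dual_cartan D.
Proof.
move=> Aii; rewrite /srefl lfunE /= lfunE /= lfunE /= sroot_coroot Aii rmorph_nat.
rewrite -addrA -opprD -scalerDl [X in X *: _](_ : _ = 0) ?scale0r ?subr0 //.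
by rewrite /GRing.scale /=; ring.
Qed.

Lemma wt_dominant_conjugate nu : wt V nu -> exists g mu,
  [/\ weyl (I_V lam V) g, wt V mu, condC1 lam V mu & nu = g mu].
Proof.
move=> wnu; have /(wtP v0P)[w nuE _] := wnu.
have [k] := ubnP (size w); elim: k w nu nuE wnu => // k IH w nu nuE wnu wk.
have [dom|] := pselect (condC1 lam V nu).
  by exists idfun, nu; split=> //; apply: weyl_id.
move=> /existsNP[i /not_implyP[iV nn]]; have [ip _] := iV.
have [z nuz] := wt_coroot_int iV wnu.
case: z nuz => p nuz; first by case: nn; exists p; rewrite nuz -pmulrn.
rewrite NegzE mulrNz -pmulrn in nuz.
have snu := wt_srefl iV wnu; have /(wtP v0P)[w' w'E _] := snu.
have ww' : perm_eq w (w' ++ nseq p.+1 i).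
  rewrite -cont_perm; apply/eqP/(@lincomb_inj _ _ _ D); rewrite -!wsum_cont wsum_cat.
  apply/oppr_inj/(addrI lam); rewrite -nuE opprD addrA -w'E /srefl nuz scaleNr opprK.
  rewrite /wsum big_nseq -[X in _ - X](_ : p.+1%:R *: sroot D i = _) ?addrK //.
  by rewrite scaler_nat -Monoid.iteropE.
have [|g [mu [gW wmu dom gmu]]] := IH w' _ w'E snu.
  move: wk; rewrite (perm_size ww') size_cat size_nseq addnS ltnS.
  exact: leq_ltn_trans (leq_addr _ _).
exists (srefl i \o g), mu; split=> //; first exact: weyl_srefl.
by rewrite /= -gmu sreflK // (cartan_real ip).
Qed.

End Weyl.

Section Simple.
Variables (R : realType) (I : finType) (A : I -> I -> R).
Hypothesis hA : bkm_cartan_matrix A.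
Variables (D : realization A) (lam : dual_cartan D) (V : lieModType (bkm D)).

Local Notation e i := (act (bkm_e D i)).

Lemma simple_singular_eq0 (v0 : V) w : hw_vector lam v0 -> simple_module V ->
  w != [::] -> (forall i, e i (fword w v0) = 0) -> fword w v0 = 0.
Proof.
move=> v0P [_ V_simple] wn sing; case: (v0P) => v0n0 _ lamv0 _.
pose N : set V := lspan (fun u => exists2 t : seq I, True & u = fword t (fword w v0)).
have xw := wt_space_fword w lamv0.
have NS : submodule N.
  split; first exact: lspan0.
    by move=> a u v uN vN; apply: lspanD => //; apply: lspanZ.
  by move=> x v; apply: singular_span_act xw sing x v.
case: (V_simple N NS) => NE.
  have : N (fword w v0) by apply: lspan_sub; exists [::].
  by rewrite NE.
have : N v0 by rewrite NE.
move=> v0N; case/eqP: v0n0.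
apply: (@word_span_wt _ _ _ _ _ _ _ v0P (fun t => t != [::]) lam) => //.
  by move=> t tn _; apply: wsum_neq0.
apply: (@lspan_map _ _ _ idfun _ _ _ _ v0N) => _ [t _ ->].
apply: lspan_sub; exists (t ++ w); last by rewrite /= fword_cat.
by case: t.
Qed.

Lemma simple_nice : simple_highest_weight_module lam V -> nice lam V.
Proof.
move=> [/hw_vector_exists[v0 v0P] V_simple] [H m] [mh mmin] /=.
case: (v0P) => _ ev0 lamv0 _.
have [[H0 HJ HI] [m0 m1 m2] _] := mh.
have [i iH] := set0Pn _ H0; have mi := hole_gt0 hA mh iH.
have fi0 : fword (nseq (m i) i) v0 = 0.
  apply: (simple_singular_eq0 v0P V_simple); first by case: (m i) mi.
  move=> j; have [<-|ij] := eqVneq i j; last first.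
    have := e_fword j (nseq (m i) i) lamv0; rewrite ev0 linear0 subr0.
    apply: lspan_eq0 => u [t /perm_mem/(_ j)]; rewrite mem_head => /esym.
    by rewrite mem_nseq eq_sym (negbTE ij) andbF.
  rewrite fword_nseq; case mE: (m i) mi => [//|k] _.
  rewrite (e_iter_f k lamv0) // [X in X *: _](_ : _ = 0) ?scale0r //.
  have [n lamn] := HJ i iH.
  apply/eqP; rewrite mulf_eq0 pnatr_eq0 /= subr_eq0.
  have [Ai0|Ai0] := eqVneq (A i i) 0; first by rewrite lamn Ai0 !(mulr0, mul0r).
  have : (m i)%:R = 2 / (A i i)%:C * lam (coroot D i) + 1.
    apply: m1 => //; rewrite !inE; case/orP: (cartan_diag hA i) => [|Aii].
      by rewrite inE => ->.
    by rewrite lt_neqAle Ai0 Aii orbT.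
  rewrite mE -natr1 => /addIr->; apply/eqP; field.
  by rewrite (inj_eq (@complexI R) _ 0).
pose m' : {ffun I -> nat} := [ffun j => if j == i then m i else 0%N].
have iJ j : j \in [set i]%SET -> j = i by rewrite inE => /eqP.
have mi' : m' i = m i by rewrite ffunE eqxx.
have h' : hole lam V ([set i]%SET, m').
  split; [split|split|].
  - by apply/set0Pn; exists i; rewrite inE.
  - by move=> j /iJ->; apply: HJ.
  - by move=> j k /iJ-> /iJ->; rewrite eqxx.
  - by move=> j; rewrite inE ffunE => /negbTE->.
  - by move=> j /iJ->; rewrite mi'; apply: m1.
  - by move=> j /iJ->; rewrite mi'; apply: m2.
  move=> v /(wt_space_lam v0P)[a ->].
  by rewrite fprod_fword enum_set1 /= cats0 mi' linearZ /= fi0 scaler0.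
have HE : H = [set i]%SET.
  apply: contrapT => HN; apply: mmin; exists ([set i]%SET, m'); split=> //=.
  - by case=> HE _; apply: HN.
  - by rewrite sub1set.
  - by move=> j /iJ->; rewrite mi'.
rewrite HE cards1 !sub1set; case/orP: (cartan_diag hA i) => [ip|]; first by right.
by rewrite le_eqVlt => /orP[/eqP Ai|Ai]; left; rewrite !inE Ai ?eqxx ?orbT.
Qed.

End Simple.

Theorem theorem3p1 (R : realType) (I : finType) (A : I -> I -> R)
    (hA : bkm_cartan_matrix A) (D : realization A) (lam : dual_cartan D) :
  (forall V : lieModType (bkm D),
     highest_weight_module lam V -> nice lam V ->
     wt V = [set nu | exists w mu, weyl (I_V lam V) w /\ wt_le mu lam /\
               condC1 lam V mu /\ condC2 lam V mu /\ nu = w mu]%classic) /\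
  (forall V : lieModType (bkm D),
     simple_highest_weight_module lam V -> nice lam V).
Proof.
split=> [V Vhw Vnice|V]; last exact: simple_nice.
have [v0 v0P] := hw_vector_exists Vhw.
apply/seteqP; split=> [nu /(wt_dominant_conjugate hA v0P)|nu].
  move=> [w [mu [wW wmu C1 ->]]]; exists w, mu.
  have mu_le : wt_le mu lam.
    have /(wtP v0P)[t muE t0] := wmu; exists (cont t).
    by rewrite muE -wsum_cont opprB addrC subrK.
  by do ![split=> //]; apply: wt_condC2 v0P _ wmu.
move=> [w [mu [wW [_ [C1 [C2 ->]]]]]].
apply: (wt_weyl hA v0P wW); exact: (condC2_wt hA v0P).
Qed.
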